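(* Let $\pi$ be a set of primes and let $G$ be a finite $\pi$-separable group. If $G$ is a pseudo-$M_\pi$-group and $N$ is a normal Hall subgroup of $G$, then $N$ is also a pseudo-$M_\pi$-group.
   Context: All groups are finite. A Hall subgroup of $G$ is a subgroup whose order is coprime to its index. Let $\pi$ be a set of primes and $\pi'$ its complement. A group is $\pi$-separable if it has a normal series each of whose factors is a $\pi$-group or a $\pi'$-group (subgroups of $\pi$-separable groups are $\pi$-separable). Let $G$ be $\pi$-separable. $G^o$ is the set of $\pi$-elements of $G$ (elements whose order is a $\pi$-number). The $\pi$-partial characters of $G$ are the restrictions to $G^o$ of (ordinary, possibly reducible, nonzero) complex characters of $G$. $\mathrm{I}_\pi(G)$ is the set of irreducible $\pi$-partial characters, i.e. those that cannot be written as a sum of two $\pi$-partial characters. For $H\le G$ and a $\pi$-partial character $\psi$ of $H$, the induced $\pi$-partial character is $\psi^G(x)=\frac{1}{|H|}\sum_{g\in G,\ gxg^{-1}\in H}\psi(gxg^{-1})$ for $x\in G^o$. For $\varphi\in\mathrm{I}_\pi(G)$ put $S(\varphi)=\{\psi\in\mathrm{I}_\pi(H)\mid H\le G,\ \psi^G=\varphi\}$ (where $H=G$ is allowed). The partial character $\varphi$ is pseudo monomial if $\gcd\{\psi(1)\mid\psi\in S(\varphi)\}=1$. The group $G$ is a pseudo-$M_\pi$-group if every $\varphi\in\mathrm{I}_\pi(G)$ is pseudo monomial. *)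

(* Defs.v *)
From HB Require Import structures.
From mathcomp Require Import all_boot all_order all_algebra.
From mathcomp Require Import all_fingroup all_solvable all_field all_character.

Set Implicit Arguments.
Unset Strict Implicit.
Unset Printing Implicit Defensive.

Import GroupScope GRing.Theory.
Local Open Scope ring_scope.

Section PiTheory.

Variables (gT : finGroupType) (pi : nat_pred).
Implicit Types G H : {group gT}.

Definition pi_factor (G A B : {set gT}) : bool :=
  [&& A \subset B, B <| G & pi.-group (B / A)%g || pi^'.-group (B / A)%g].

Definition pi_separable G : Prop :=
  exists2 s : seq {group gT}, (pi_factor G).-series 1%G s & last 1%G s = G.

Definition pi_elements G : {set gT} := [set x in G | pi.-elt x].

(* A function on the pi-elements of G is represented by its extension by zero *)
(* to G; this loses no information and allows partial characters to be added, *)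
(* compared and induced as class functions.                                   *)
Definition pi_res G (chi : 'CF(G)) : 'CF(G) := '1_(pi_elements G) * chi.

Lemma pi_resE G (chi : 'CF(G)) x :
  pi_res chi x = if x \in pi_elements G then chi x else 0.
Proof.
rewrite cfunE cfunElock genGid inE; case Gx: (x \in G); last by rewrite mul0r.
suff -> : (x ^: G \subset pi_elements G) = pi.-elt x.
  by case: ifP; rewrite (mul1r, mul0r).
apply/subsetP/idP => [/(_ x (class_refl G x)) | pi_x y /imsetP[g Gg ->]].
  by rewrite inE => /andP[].
by rewrite inE groupJ // p_eltJ.
Qed.

Definition pi_char G (phi : 'CF(G)) : Prop :=
  exists chi : 'CF(G), [/\ chi \is a character, chi != 0 & phi = pi_res chi].

Definition pi_irr G (phi : 'CF(G)) : Prop :=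
  pi_char phi /\
  ~ exists phi1 phi2 : 'CF(G),
      [/\ pi_char phi1, pi_char phi2 & phi = phi1 + phi2].

(* On extensions by zero, 'Ind is the induction of pi-partial characters. *)
Lemma pi_IndE G H (psi : 'CF(H)) x : H \subset G ->
  'Ind[G] psi x =
  #|H|%:R^-1 * \sum_(g in G | (g * x * g^-1)%g \in H) psi (g * x * g^-1)%g.
Proof.
move=> sHG; rewrite cfIndE //; congr (_ * _).
rewrite (reindex_inj invg_inj) /= (eq_bigl (mem G)) => [|g]; last first.
  exact: groupV.
rewrite big_mkcondr /=; apply: eq_bigr => g _.
rewrite conjgE invgK mulgA; case: ifP => // H'y; exact: cfun0 (negbT H'y).
Qed.

Definition induces G (phi : 'CF(G)) H (psi : 'CF(H)) : Prop :=
  [/\ H \subset G, pi_irr psi & 'Ind[G] psi = phi].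

Definition inducing_degree G (phi : 'CF(G)) (n : nat) : Prop :=
  exists H (psi : 'CF(H)), induces phi psi /\ psi 1%g = n%:R.

Definition is_gcd (A : nat -> Prop) (d : nat) : Prop :=
  (forall n, A n -> (d %| n)%N) /\
  (forall e, (forall n, A n -> (e %| n)%N) -> (e %| d)%N).

Definition pseudo_monomial G (phi : 'CF(G)) : Prop :=
  is_gcd (inducing_degree phi) 1.

Definition pseudo_M_group G : Prop :=
  forall phi : 'CF(G), pi_irr phi -> pseudo_monomial phi.

End PiTheory.

(* Main.v *)
Require Import Defs.
From mathcomp Require Import all_boot all_order all_algebra.
From mathcomp Require Import all_fingroup all_solvable all_field all_character.

(* For every normal subgroup M of G obtained by intersecting N with a term of *)
(* a pi-series, there is a G-stable set B of irreducible characters of M      *)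
(* whose restrictions to pi-elements form a basis, in duality with characters *)
(* supported on pi-elements: the latter are induced from pi-subgroups, and B  *)
(* plays the role of Isaacs' canonical lifts.  B climbs the series by taking  *)
(* all constituents above B across a pi-factor and canonical extensions       *)
(* across a pi'-factor.  In this basis partial characters of N have natural   *)
(* coordinates.                                                               *)
(* Let phi be the restriction of a member beta of B.  By coprimeness beta     *)
(* extends to its stabilizer, and inducing to G gives a character lying over  *)
(* each G-conjugate of beta once and over nothing else in B, so its           *)
(* restriction is irreducible, hence pseudo monomial.  If it is induced from  *)
(* a partial character of H, lift the latter to an ordinary irreducible h;    *)
(* again by coprimeness a constituent a of h on the intersection of H and N   *)
(* induces irreducibly to N, its degree divides that of h, and the induced    *)
(* character restricts to a G-conjugate of phi.                               *)

(** The characters of N are controlled by [fong_basis_exists]: a G-stable [B] in Irr(N), together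
    with characters [F i] supported on pi-elements and dual to [B] ([fong_basis_dual]). Coordinates
    of partial characters in this basis are natural numbers, so every member of I_pi(N) is the
    restriction of some member of [B] ([pi_irr_fong]), and irreducibility over G can be tested on
    coordinates ([orbit_pi_irr]).

    The delicate point in building [B] is that it still spans after a pi-factor. This is checked on
    one coset of L in C = L<x> at a time ([coset_spanning]): a count in the style of Brauer's
    permutation lemma matches the C-invariant members of [B] with the C-classes of pi-elements in
    the coset, and extensions of the former, cut down to the coset, are independent.

    The Hall hypothesis enters through degrees. By [coprime_irr_degree] the ratio chi(1)/theta(1),
    for theta in Irr(N) under chi, divides |G : N|, while degrees of characters of N divide |N|. In
    [normal_Hall_Ind_irr] and [orbit_constituent] a multiplicity divides both numbers, hence is 1.
    Consequently each degree inducing the orbit character of G is a multiple of a degree inducing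
    phi, and a common divisor of the latter divides 1. *)

Set Implicit Arguments.
Unset Strict Implicit.
Unset Printing Implicit Defensive.

Import GroupScope Order.TTheory GRing.Theory Num.Theory.
Local Open Scope ring_scope.

(** * Restriction to a supplement *)

Section Restriction.

Variable gT : finGroupType.
Implicit Types G H K L M N S T : {group gT}.

(** Mackey's formula when there is a single double coset. *)
Lemma cfRes_Ind_mul G H K I (phi : 'CF(K)) :
    (H * K)%g = G -> H :&: K = I ->
  'Res[H] ('Ind[G] phi) = 'Ind[H] ('Res[I] phi).
Proof.
move=> defG <-{I}.
have [sHG sKG] : H \subset G /\ K \subset G.
  by apply/andP; rewrite -mulG_subG defG.
have sIH : H :&: K \subset H := subsetIl H K.
apply/cfun_inP=> x Hx; rewrite cfResE // !cfIndE //.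
pose F y := phi (x ^ y)%g.
have FK y z : z \in K -> F (y * z)%g = F y.
  by move=> Kz; rewrite /F conjgM (cfunJ _ _ Kz).
(* [F] is constant on the cosets yK and [G] is the product of [H] and [K], so the sum of F(h y) over
   h in [H] is the same for every y in [G]. *)
have sumF : #|H|%:R * (\sum_(y in G) F y) = #|G|%:R * (\sum_(y in H) F y).
  rewrite -!sumr_const !mulr_suml; transitivity (\sum_(h in H) \sum_(y in G) F (h * y)%g).
    apply: eq_bigr => h /(subsetP sHG) Gh; rewrite mul1r (reindex_inj (mulgI h)) /=.
    by apply: eq_bigl => y; rewrite groupMl.
  rewrite exchange_big /=; apply: eq_bigr => y; rewrite -{1}defG.
  case/mulsgP=> h k Hh Kk ->; rewrite mul1r [RHS](reindex_inj (mulIg h)) /=.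
  apply: eq_big => [z | z Hz]; first by rewrite groupMr.
  by rewrite mulgA FK.
have -> : \sum_(y in H) ('Res[H :&: K] phi) (x ^ y)%g = \sum_(y in H) F y.
  apply: eq_bigr => y Hy; have Hxy : (x ^ y)%g \in H by rewrite groupJ.
  have [Kxy | K'xy] := boolP ((x ^ y)%g \in K); first by rewrite cfResE ?subsetIr ?inE ?Hxy.
  by rewrite /F !cfun0 // inE (negPf K'xy) andbF.
apply: (mulfI (neq0CG H)); rewrite mulrCA sumF mulrA [RHS]mulrA; congr (_ * _).
apply/eqP; rewrite mulrC eqr_div ?neq0CG //.
by rewrite -!natrM (mul_cardG H K) defG.
Qed.

Lemma cfRes_invariant_irr (L K : {group gT}) (i : Iirr L) (j : Iirr K) :
  K <| L -> L \subset 'I['chi_j] -> j \in irr_constt ('Res[K] 'chi_i) ->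
  'Res[K] 'chi_i = '['Res[K] 'chi_i, 'chi_j] *: 'chi_j.
Proof.
move=> nsKL IL jKi; rewrite {1}(Clifford_Res_sum_cfclass nsKL jKi).
by rewrite cfclass_invariant ?big_seq1.
Qed.

Lemma char_constt_eq (L : {group gT}) (chi : 'CF(L)) (i : Iirr L) :
    chi \is a character -> i \in irr_constt chi -> chi 1%g = 'chi_i 1%g ->
  chi = 'chi_i.
Proof.
move=> Nchi ichi; have [psi Npsi ->] := constt_charP i Nchi ichi.
rewrite cfunE -[RHS]addr0 => /addrI/eqP; rewrite char1_eq0 // => /eqP->.
by rewrite addr0.
Qed.

Lemma constt_Res_cfclass (L K : {group gT}) (i : Iirr L) (j k : Iirr K) :
    K <| L -> j \in irr_constt ('Res[K] 'chi_i) ->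
    k \in irr_constt ('Res[K] 'chi_i) ->
  exists2 g, g \in L & k = conjg_Iirr j g.
Proof.
move=> nsKL jKi; rewrite irr_consttE (Clifford_Res_sum_cfclass nsKL jKi).
rewrite cfdotZl mulf_eq0 => /norP[_]; rewrite cfdot_suml => nz_sum.
suff /cfclassP[g Lg kE] : 'chi_k \in ('chi_j ^: L)%CF.
  by exists g => //; apply: irr_inj; rewrite conjg_IirrE.
apply: contraR nz_sum => j'k; rewrite big_seq big1 // => xi /cfclassP[g Lg xiE].
rewrite xiE -conjg_IirrE cfdot_irr; case: eqP => // kE; case/negP: j'k.
by rewrite -kE conjg_IirrE; apply/cfclassP; exists g.
Qed.

Lemma constt_Res_conjg (L K : {group gT}) (i : Iirr L) (j : Iirr K) g :
    g \in 'N(L) -> g \in 'N(K) ->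
  (conjg_Iirr j g \in irr_constt ('Res[K] 'chi_(conjg_Iirr i g))) =
  (j \in irr_constt ('Res[K] 'chi_i)).
Proof.
by move=> nLg nKg; rewrite !irr_consttE !conjg_IirrE -cfConjgRes_norm // cfConjg_iso.
Qed.

(** Frattini argument: an element fixing ['chi_i] permutes its constituents on [K], and [L] is
    transitive on these by Clifford, so it can be corrected by an element of [L]. *)
Lemma Inertia_over_sub (G K L : {group gT}) (i : Iirr L) (j : Iirr K) :
    K <| G -> L <| G -> K \subset L -> j \in irr_constt ('Res[K] 'chi_i) ->
  'I_G['chi_i] \subset ('I_G['chi_j] * L)%g.
Proof.
move=> nsKG nsLG sKL ji; have [sLG sKG] := (normal_sub nsLG, normal_sub nsKG).
have [nKG nLG] := (subsetP (normal_norm nsKG), subsetP (normal_norm nsLG)).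
apply/subsetP=> g /setIP[Gg Ig].
have jgi : conjg_Iirr j g \in irr_constt ('Res[K] 'chi_i).
  have -> : i = conjg_Iirr i g by apply: irr_inj; rewrite conjg_IirrE inertiaJ.
  by rewrite constt_Res_conjg ?nLG ?nKG.
have [l Ll jgE] := constt_Res_cfclass (normalS sKL sLG nsKG) ji jgi.
have Gl := subsetP sLG l Ll; rewrite -[g](mulgKV l) mem_mulg //.
rewrite in_setI groupM ?groupV //= inE groupM ?groupV ?nKG //=.
rewrite cfConjgMnorm ?groupV ?nKG // -conjg_IirrE jgE conjg_IirrE.
by rewrite cfConjgK.
Qed.

Section MultiplicityOne.

Variables (T M S J : {group gT}) (m : Iirr M) (a : Iirr J).
Hypotheses (nsMT : M <| T) (defT : (M * S)%g = T) (defJ : M :&: S = J).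
Hypotheses (IT : T \subset 'I['chi_m]) (IS : S \subset 'I['chi_a]).
Hypothesis res1 : '['Res[J] 'chi_m, 'chi_a] = 1.

Let sMT : M \subset T := normal_sub nsMT.
Let sST : S \subset T. Proof. by rewrite -defT mulG_subr. Qed.
Let nsJS : J <| S.
Proof. by rewrite -defJ /normal subsetIr normsI ?normG // (subset_trans sST) ?normal_norm. Qed.

(* The multiplicities n(eta, s) of Irr(S | a) in Irr(T | m), and the vectors   *)
(* e, f of ramification indices, satisfy n f = e and n^t e = f; as the entries *)
(* are natural numbers, n is a permutation matrix.                             *)
Lemma irr_multiplicity_one_corr (i : Iirr T) :
    m \in irr_constt ('Res[M] 'chi_i) ->
  exists s : Iirr S,
    [/\ '['Res[J] 'chi_s, 'chi_a] = '['Res[M] 'chi_i, 'chi_m],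
        forall s', a \in irr_constt ('Res[J] 'chi_s') ->
          '['Res[S] 'chi_i, 'chi_s'] = (s' == s)%:R
      & forall j, m \in irr_constt ('Res[M] 'chi_j) ->
          '['Res[S] 'chi_j, 'chi_s] = (j == i)%:R].
Proof.
move=> mi; have [sJM sJS] : J \subset M /\ J \subset S by rewrite -defJ subsetIl subsetIr.
pose e j := '['Res[M] 'chi[T]_j, 'chi_m].
pose f s := '['Res[J] 'chi[S]_s, 'chi_a].
pose n (j : Iirr T) (s : Iirr S) := '['Res[S] 'chi_j, 'chi_s].
have Ne j : e j \in Num.nat by rewrite Cnat_cfdot_char_irr ?cfRes_char ?irr_char.
have Nf s : f s \in Num.nat by rewrite Cnat_cfdot_char_irr ?cfRes_char ?irr_char.
have Nn j s : n j s \in Num.nat by rewrite Cnat_cfdot_char_irr ?cfRes_char ?irr_char.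
have nf j : m \in irr_constt ('Res[M] 'chi_j) -> \sum_s n j s * f s = e j.
  move=> mj; transitivity '['Res[J] 'chi_j, 'chi_a].
    rewrite -(cfResRes _ sJS sST) ['Res[S] 'chi_j]cfun_sum_cfdot.
    by rewrite linear_sum cfdot_suml; apply: eq_bigr => s _; rewrite linearZ cfdotZl.
  rewrite -(cfResRes _ sJM sMT) (cfRes_invariant_irr nsMT IT mj).
  by rewrite linearZ cfdotZl /= res1 mulr1.
have ne s : f s != 0 -> \sum_j e j * n j s = f s.
  move=> nzf; transitivity '['Res[S] ('Ind[T] 'chi_m), 'chi_s].
    rewrite ['Ind _]cfun_sum_cfdot linear_sum cfdot_suml; apply: eq_bigr => j _.
    rewrite linearZ cfdotZl; congr (_ * _); rewrite -cfdot_Res_r cfdotC_char //.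
      by rewrite irr_char.
    by rewrite cfRes_char ?irr_char.
  rewrite (cfRes_Ind_mul _ _ (etrans (setIC S M) defJ)); last first.
    by rewrite -defT normC // (subset_trans sST) ?normal_norm.
  have aS : a \in irr_constt ('Res[J] 'chi_s) by rewrite irr_consttE.
  rewrite -cfdot_Res_r (cfRes_invariant_irr nsJS IS aS) cfdotZr res1 ?mulr1.
  exact: conj_natr (Nf s).
(* Row [i] of the product of n with its transpose, over the [s] above [a]. By [nf] and [ne] the sum
   of e j K j is e i, while K i is a positive integer; hence K i = 1 and K vanishes at every other j
   above [m]. *)
pose K j := \sum_(s | f s != 0) n i s * n j s.
have NK j : K j \in Num.nat by rewrite rpred_sum // => s _; rewrite rpredM.
have sumK : \sum_j e j * K j = e i.
  rewrite -(nf i mi) (bigID (fun s => f s == 0)) /= addrC [X in _ = _ + X]big1 => [|s /eqP->].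
    rewrite addr0 /K; under eq_bigr do rewrite mulr_sumr.
    rewrite exchange_big; apply: eq_bigr => s nzf.
    by rewrite -(ne s nzf) mulr_sumr; apply: eq_bigr => j _; rewrite mulrCA.
  by rewrite mulr0.
have nz_ei : e i != 0 by [].
have Ki_ge1 : 1 <= K i.
  have : K i != 0.
    apply: contraNneq nz_ei => Ki0; rewrite -(nf i mi); apply/eqP.
    apply: big1 => s _; have [-> | nzf] := eqVneq (f s) 0; first by rewrite mulr0.
    have : n i s * n i s = 0.
      by apply: (psumr_eq0P _ Ki0) => // s' _; rewrite mulr_ge0 ?natr_ge0.
    by move/eqP; rewrite mulf_eq0 orbb => /eqP->; rewrite mul0r.
  by case/natrP: (NK i) => k ->; rewrite pnatr_eq0 -lt0n (ler_nat _ 1).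
have [Ki1 K0] : K i = 1 /\ forall j, j != i -> e j * K j = 0.
  have ge0 j : 0 <= e j * K j by rewrite mulr_ge0 ?natr_ge0.
  have := sumK; rewrite (bigD1 i) //= => def_ei.
  have rest_ge0 : 0 <= \sum_(j | j != i) e j * K j by apply: sumr_ge0.
  have ei_gt0 : 0 < e i by rewrite lt_def nz_ei natr_ge0.
  have le1 : K i <= 1.
    by rewrite -(ler_pM2l ei_gt0) mulr1 -{2}def_ei lerDl.
  have Ki1 : K i = 1 by apply: le_anti; rewrite le1.
  split=> //; apply: psumr_eq0P => [j _ //|].
  by apply: (addrI (e i)); rewrite addr0 -{2}def_ei Ki1 mulr1.
(* [K i] is a sum of squares of natural numbers equal to 1, so a single entry is 1 and the others
   vanish. *)
have [|s [nzfs /eqP nis nis']] := natr_sum_eq1 _ Ki1; first by move=> s _; rewrite rpredM.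
have {}nis : n i s = 1.
  by move: nis; case/natrP: (Nn i s) => k ->; rewrite -natrM pnatr_eq1 muln_eq1 => /andP[/eqP->].
have nj j : m \in irr_constt ('Res[M] 'chi_j) -> n j s = (j == i)%:R.
  move=> mj; have [-> // | ne_ji] := eqVneq j i.
  have /eqP := K0 j ne_ji; rewrite mulf_eq0 => /orP[/eqP ej0|/eqP Kj0].
    by rewrite irr_consttE -/(e j) ej0 eqxx in mj.
  have : n i s * n j s = 0.
    by apply: (psumr_eq0P _ Kj0) => // s' _; rewrite mulr_ge0 ?natr_ge0.
  by rewrite nis mul1r.
exists s; split=> //.
- rewrite -/(e i) -/(f s) -(ne s nzfs) (bigD1 i) //= nis mulr1 big1 ?addr0 // => j ne_ji.
  have [mj | ] := boolP (m \in irr_constt ('Res[M] 'chi_j)).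
    by rewrite nj // (negPf ne_ji) mulr0.
  by rewrite irr_consttE negbK -/(e j) => /eqP->; rewrite mul0r.
- move=> s' /= aS'; have [-> | ne_ss'] := eqVneq s' s; first by rewrite -/(n i s) nis.
  by have /eqP := nis' s' ne_ss' aS'; rewrite mulf_eq0 orbb => /eqP.
Qed.

End MultiplicityOne.

End Restriction.

(** * Extension of invariant characters *)

Section CoprimeExtension.

Variables (gT : finGroupType) (G N : {group gT}) (d : nat).
Variable Y : mx_representation algC N d.
Hypothesis nsNG : N <| G.

Let sNG : N \subset G := normal_sub nsNG.
Let nNG : G \subset 'N(N) := normal_norm nsNG.
Let chi := cfRepr Y.

Hypotheses (irrY : mx_irreducible Y) (IG : G \subset 'I[chi]).

Let d_gt0 : (0 < d)%N.
Proof. by case/mx_irrP: irrY. Qed.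

Let absY : mx_absolutely_irreducible Y.
Proof. exact: groupC. Qed.

(** The determinant is normalised to 1 so that the determinants of the projective extension remain
    roots of unity of order dividing that of det chi. *)
Let intertwining (g : gT) (A : 'M[algC]_d) :=
  [/\ A \in unitmx, \det A = 1
    & {in N, forall x, Y x *m A = A *m Y (x ^ g)%g}].

Lemma intertwining_exists g : g \in G -> exists A, intertwining g A.
Proof.
move=> Gg; have nNg := subsetP nNG g Gg.
pose Yg x := Y (x ^ g)%g.
have Yg_repr : mx_repr N Yg.
  split=> [|x y Nx Ny]; first by rewrite /Yg conj1g repr_mx1.
  by rewrite /Yg conjMg repr_mxM ?memJ_norm.
pose rYg := MxRepresentation Yg_repr.
have eq_chi : cfRepr Y = cfRepr rYg.
  apply/cfun_inP=> x Nx; rewrite -/chi -(inertia_valJ x (subsetP IG g Gg)).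
  by rewrite !cfunE memJ_norm.
have [A _ freeA homA] := cfRepr_inj eq_chi.
have uA : A \in unitmx by rewrite -row_free_unit.
pose c := d.-root (\det A)^-1.
have cd : c ^+ d = (\det A)^-1 by rewrite rootCK.
have nzA : \det A != 0 by rewrite -unitfE -unitmxE.
have uc : c \is a GRing.unit.
  by rewrite unitfE; apply: contra_neq (invr_neq0 nzA) => c0; rewrite -cd c0 expr0n gtn_eqF.
exists (c *: A); split=> [||x Nx]; first by rewrite unitmxZ.
  by rewrite detZ cd mulVf.
by rewrite -scalemxAr homA // scalemxAl.
Qed.

Lemma projective_extension :
  exists X : gT -> 'M[algC]_d,
  [/\ {in G, forall g, X g \in unitmx /\ \det (X g) ^+ 'o(chi)%CF = 1},
      {in N & G, forall x g, Y x *m X g = X g *m Y (x ^ g)%g},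
      {in G & N, forall g x, X (g * x)%g = X g *m Y x}
    & {in N, X =1 Y}].
Proof.
(* The choice at 1 is forced to be the identity, so that [X] agrees with [Y] on [N]. *)
have /fin_all_exists[A intA] (g : gT) : exists A, g \in G ->
    intertwining g A /\ (g = 1%g -> A = 1%:M).
  have [Gg | _] := boolP (g \in G); last by exists 0.
  have [-> | nt_g] := eqVneq g 1%g.
    exists 1%:M => _; split=> //; split; rewrite ?unitmx1 ?det1 // => x Nx.
    by rewrite mul1mx mulmx1 conjg1.
  by have [A intA] := intertwining_exists Gg; exists A => _; split=> // /eqP; rewrite (negPf nt_g).
pose t g := repr (coset N g).
have tP g : g \in G -> t g \in G /\ ((t g)^-1 * g)%g \in N.
  move=> Gg; have nNg := subsetP nNG g Gg.
  have := mem_repr_coset (coset N g); rewrite val_coset // => /rcosetP[n Nn tE].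
  have -> : t g = (n * g)%g by rewrite -tE -val_coset.
  split; first by rewrite groupM // (subsetP sNG).
  by rewrite invMg -mulgA -conjgE memJ_norm ?groupV.
have t1 : t 1%g = 1%g by rewrite /t coset_id // repr_coset1.
exists (fun g => A (t g) *m Y ((t g)^-1 * g)%g); split.
- move=> g Gg; have [Gt Nt] := tP g Gg; have [[uA dA _] _] := intA _ Gt.
  split; first by rewrite unitmx_mul uA repr_mx_unit.
  rewrite det_mulmx dA mul1r.
  have := exp_cforder (cfDet chi); rewrite cfDetRepr => /cfunP/(_ ((t g)^-1 * g)%g).
  rewrite exp_cfunE // cfunE Nt mulr1n trace_mx11 cfun1E Nt mxE => detY.
  by rewrite -[RHS]detY -cfDetRepr.
- move=> x g Nx Gg; have [Gt Nt] := tP g Gg; have [[_ _ homA] _] := intA _ Gt.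
  have Nxt : (x ^ t g)%g \in N by rewrite memJ_norm ?(subsetP nNG).
  rewrite mulmxA homA // -!mulmxA -!repr_mxM ?memJ_norm ?(subsetP nNG) //.
  by congr (_ *m Y _); rewrite !conjgE !mulgA !mulgK.
- move=> g x Gg Nx; have [Gt Nt] := tP g Gg.
  have -> : t (g * x)%g = t g by rewrite /t coset_kerr.
  by rewrite -mulmxA -repr_mxM // mulgA.
move=> x Nx; have [_ A1] := intA _ (group1 G).
have -> : t x = 1%g by rewrite /t coset_id // repr_coset1.
by rewrite A1 // mul1mx invg1 mul1g.
Qed.

Let unitmx_neq0 (A : 'M[algC]_d) : A \in unitmx -> A != 0.
Proof.
move/mulmxV=> AV; apply: contraTneq d_gt0 => A0; move: AV; rewrite A0 mul0mx.
by move/(congr1 mxtrace)/esym/eqP; rewrite mxtrace1 mxtrace0 pnatr_eq0 -leqn0 -ltnNge.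
Qed.

(** With m the order of x modulo [N], the m-th power of an intertwiner for x differs from Y(x^m) by
    a scalar (Schur). Rescaling by an m-th root gives A with A^m = Y(x^m), which makes x^i y |-> A^i
    Y(y) well defined. *)
Lemma cyclic_repr_extendible x :
    x \in G -> (N * <[x]>)%g = G ->
  exists Z : mx_representation algC G d, {in N, Z =1 Y}.
Proof.
move=> Gx defG; have nNx := subsetP nNG x Gx.
have [A0 [uA0 _ homA0]] := intertwining_exists Gx.
pose m := #[coset N x]%g; have m_gt0 : (0 < m)%N := order_gt0 _.
have Nxm i : (x ^+ i \in N)%g = (m %| i)%N.
  rewrite order_dvdn -morphX //; apply/idP/eqP => [|coset1]; first exact: coset_id.
  by apply: coset_idr; rewrite ?groupX.
have NxmN : (x ^+ m)%g \in N by rewrite Nxm.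
have uX i (A : 'M[algC]_d) : A \in unitmx -> A ^+ i \in unitmx.
  by move=> uA; elim: i => [|i IHi]; rewrite ?unitmx1 // exprS unitmx_mul uA.
have homX (A : 'M[algC]_d) : {in N, forall y, Y y *m A = A *m Y (y ^ x)%g} ->
    forall i, {in N, forall y, Y y *m A ^+ i = A ^+ i *m Y (y ^ (x ^+ i))%g}.
  move=> homA; elim=> [|i IHi] y Ny; first by rewrite expr0 mulmx1 mul1mx expg0 conjg1.
  have Nyi : (y ^ (x ^+ i))%g \in N by rewrite memJ_norm ?groupX.
  by rewrite exprSr mulmxA IHi // -mulmxA homA // mulmxA expgSr conjgM.
have [c Dc] : exists c, A0 ^+ m *m invmx (Y (x ^+ m)%g) = c%:M.
  apply/is_scalar_mxP/(mx_abs_irr_cent_scalar absY)/centgmxP=> y Ny.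
  apply: (can_inj (mulmxK (repr_mx_unit Y NxmN))).
  have NyJ : (y ^ (x ^+ m))%g \in N by rewrite memJ_norm ?groupX.
  rewrite -[LHS]mulmxA -repr_mxM // conjgC repr_mxM //.
  by rewrite mulmxA mulmxKV ?repr_mx_unit // -[RHS]mulmxA mulmxKV ?repr_mx_unit // homX.
have A0m : A0 ^+ m = c *: Y (x ^+ m)%g.
  by rewrite -mul_scalar_mx -Dc mulmxKV ?repr_mx_unit.
have nz_c : c != 0.
  by apply: contraNneq (unitmx_neq0 (uX m _ uA0)) => c0; rewrite A0m c0 scale0r.
have [b bm] : exists b, b ^+ m = c^-1 by exists (m.-root c^-1); rewrite rootCK.
pose A := b *: A0.
have Am : A ^+ m = Y (x ^+ m)%g.
  have AE i : A ^+ i = b ^+ i *: A0 ^+ i.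
    elim: i => [|i IHi]; first by rewrite !expr0 scale1r.
    rewrite exprS IHi -[LHS]/(A *m _) /A -scalemxAl -scalemxAr scalerA -exprS.
    by rewrite [A0 ^+ i.+1]exprS.
  by rewrite AE bm A0m scalerA mulVf ?scale1r.
have homA : {in N, forall y, Y y *m A = A *m Y (y ^ x)%g}.
  by move=> y Ny; rewrite -scalemxAr homA0 // scalemxAl.
have AY i j y z : y \in N -> z \in N -> (x ^+ i * y = x ^+ j * z)%g ->
    A ^+ i *m Y y = A ^+ j *m Y z.
  wlog le_ij : i j y z / (i <= j)%N => [IH | Ny Nz].
    by case/orP: (leq_total i j) => le_ij Ny Nz eq_ij; [|apply/esym]; apply: IH.
  rewrite -(subnKC le_ij) expgD -mulgA => /mulgI yE.
  have : (x ^+ (j - i))%g \in N by rewrite -(groupMr _ Nz) -yE.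
  rewrite Nxm => /dvdnP[q jE]; rewrite exprD -mulmxE -mulmxA; congr (_ *m _).
  have NxmX e : (x ^+ m ^+ e)%g \in N by rewrite groupX.
  have YX e : Y (x ^+ m ^+ e)%g = Y (x ^+ m)%g ^+ e.
    by elim: e => [|e IHe]; rewrite ?repr_mx1 // expgS exprS repr_mxM // IHe.
  by rewrite yE jE mulnC exprM Am expgM repr_mxM // YX.
have /fin_all_exists2[i iG iN] (g : gT) :
    exists2 i, g \in G -> (x ^- i * g)%g \in N & true.
  have [Gg | _] := boolP (g \in G); last by exists 0%N.
  move: Gg; rewrite -defG -normC ?cycle_subG // => /mulsgP[_ y /cycleP[i ->] Ny ->].
  by exists i; rewrite // mulKg.
pose Z g := A ^+ i g *m Y (x ^- i g * g)%g.
have ZE j y : y \in N -> Z (x ^+ j * y)%g = A ^+ j *m Y y.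
  move=> Ny; have Gy := subsetP sNG y Ny.
  by apply: AY => //; [apply: iG; rewrite groupM ?groupX | rewrite mulKVg].
have ZY : {in N, Z =1 Y}.
  by move=> y Ny; rewrite -[y in LHS]mul1g -(expg0 x) ZE // mul1mx.
have Z_repr : mx_repr G Z.
  split=> [|g h Gg Gh]; first by rewrite ZY ?repr_mx1.
  have [Ng Nh] := (iG g Gg, iG h Gh).
  have NgJ : ((x ^- i g * g) ^ (x ^+ i h))%g \in N by rewrite memJ_norm ?groupX.
  have -> : (g * h = x ^+ (i g + i h) * ((x ^- i g * g) ^ (x ^+ i h) * (x ^- i h * h)))%g.
    by rewrite expgD conjgE !mulgA !mulgK mulgV mul1g.
  rewrite ZE ?(groupM NgJ (iG h Gh)) // repr_mxM ?iG // exprD -mulmxE -!mulmxA; congr (_ *m _).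
  by rewrite !mulmxA homX.
by exists (MxRepresentation Z_repr).
Qed.

Hypothesis coGN : coprime #|G : N| ('o(chi)%CF * d).

(* With [det X(g) ^ o(chi) = 1], the factor set [a] of [X] is killed by       *)
(* [o(chi) d], while [a ^ |G : N|] is the coboundary of the product of the    *)
(* [a(g, k)] over the cosets [k]; hence [a] is itself a coboundary.           *)
Lemma coprime_repr_extendible :
  exists Z : mx_representation algC G d, {in N, Z =1 Y}.
Proof.
have [X [XP homX XN XY]] := projective_extension.
have uX g : g \in G -> X g \in unitmx by case/XP.
have nzX g : g \in G -> X g != 0.
  by move=> Gg; apply: unitmx_neq0 (uX g Gg).
have /fin_all_exists[a aP] (g : gT) : exists a : gT -> algC,
    {in G, forall h, g \in G -> X g *m X h = a h *: X (g * h)%g}.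
  have /fin_all_exists[a aP] h : exists a : algC, h \in G -> g \in G ->
      X g *m X h = a *: X (g * h)%g.
    have [Gh | _] := boolP (h \in G); last by exists 0.
    have [Gg | _] := boolP (g \in G); last by exists 0.
    have Ggh := groupM Gg Gh.
    suffices /is_scalar_mxP[c Dc] : is_scalar_mx (X g *m X h *m invmx (X (g * h)%g)).
      by exists c => _ _; rewrite -mul_scalar_mx -Dc mulmxKV ?uX.
    apply: (mx_abs_irr_cent_scalar absY); apply/centgmxP=> x Nx.
    have nNx y : y \in G -> (x ^ y)%g \in N by move/(subsetP nNG)=> nNy; rewrite memJ_norm.
    apply: (can_inj (mulmxK (uX _ Ggh))).
    rewrite -[LHS]mulmxA homX // mulmxA mulmxKV ?uX // -[RHS]mulmxA mulmxKV ?uX //.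
    by rewrite mulmxA homX // -[RHS]mulmxA homX ?nNx // conjgM mulmxA.
  by exists a => h Gh Gg; apply: aP.
have inj_scale g c1 c2 : g \in G -> c1 *: X g = c2 *: X g -> c1 = c2.
  move=> Gg /eqP; rewrite -subr_eq0 -scalerBl scaler_eq0 (negPf (nzX g Gg)) orbF.
  by rewrite subr_eq0 => /eqP.
have aN g h x : g \in G -> h \in G -> x \in N -> a g (h * x)%g = a g h.
  move=> Gg Gh Nx; have Gx := subsetP sNG x Nx.
  apply: (inj_scale (g * (h * x))%g); rewrite ?groupM // -aP ?groupM // XN // mulmxA.
  by rewrite aP // -scalemxAl -XN ?groupM // mulgA.
have aN1 x h : x \in N -> h \in G -> a x h = 1.
  move=> Nx Gh; have Gx := subsetP sNG x Nx.
  have Nxh : (x ^ h)%g \in N by rewrite memJ_norm ?(subsetP nNG).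
  apply: (inj_scale (x * h)%g); rewrite ?groupM // -aP // scale1r XY // homX //.
  by rewrite -XN // -conjgC.
have a_coset g h k : g \in G -> h \in G -> k \in G ->
    coset N h = coset N k -> a g h = a g k.
  move=> Gg Gh Gk eq_hk; have [nNh nNk] := (subsetP nNG h Gh, subsetP nNG k Gk).
  have Nx : (k^-1 * h)%g \in N.
    apply: coset_idr; first by rewrite groupM ?groupV.
    by rewrite morphM ?groupV // morphV //= eq_hk mulVg.
  by rewrite -(mulKVg k h) aN.
have cocycle g h k : g \in G -> h \in G -> k \in G ->
    a g h * a (g * h)%g k = a g (h * k)%g * a h k.
  move=> Gg Gh Gk; apply: (inj_scale (g * h * k)%g); rewrite ?groupM //.
  rewrite -scalerA -aP ?groupM // scalemxAl -aP // -mulmxA aP // -scalemxAr aP ?groupM //.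
  by rewrite scalerA mulgA mulrC.
have a_det g h : g \in G -> h \in G -> a g h ^+ ('o(chi)%CF * d) = 1.
  move=> Gg Gh; have Ggh := groupM Gg Gh.
  have [[_ dg] [_ dh] [_ dgh]] := And3 (XP g Gg) (XP h Gh) (XP _ Ggh).
  have := congr1 (fun A => \det A ^+ 'o(chi)%CF) (aP g h Gh Gg).
  by rewrite det_mulmx detZ !exprMn dg dh dgh !mulr1 -exprM mulnC => <-.
pose r (K : coset_of N) := repr K.
have rP K : K \in (G / N)%g -> r K \in G /\ coset N (r K) = K.
  case/morphimP=> k nNk Gk ->; split; last by rewrite /r coset_reprK.
  have := mem_repr_coset (coset N k); rewrite val_coset // => /rcosetP[n Nn tE].
  by rewrite /r val_coset // tE groupM // (subsetP sNG).
pose mu g := \prod_(K in (G / N)%g) a g (r K).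
have muM g h : g \in G -> h \in G -> a g h ^+ #|G : N| * mu (g * h)%g = mu g * mu h.
  move=> Gg Gh; have [nNg nNh] := (subsetP nNG g Gg, subsetP nNG h Gh).
  have -> : mu g = \prod_(K in (G / N)%g) a g (h * r K)%g.
    rewrite /mu (reindex_inj (mulgI (coset N h))) /=; apply: eq_big => K.
      by rewrite groupMl // mem_quotient.
    rewrite groupMl ?mem_quotient // => GNK; have [GrK rK] := rP K GNK.
    have [|GrhK rhK] := rP (coset N h * K)%g; first by rewrite groupM ?mem_quotient.
    have nNr := subsetP nNG _ GrK.
    by apply: a_coset; rewrite ?groupM // rhK morphM //= rK.
  rewrite -card_quotient // -prodr_const /mu -!big_split /=; apply: eq_bigr => K GNK.
  by have [GrK _] := rP K GNK; apply: cocycle.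
(* [u] inverts |G : N| modulo the exponent killing [a], so [a], being the [u]-th power of its |G :
   N|-th power, is the coboundary of mu^u. *)
have [u um1] : exists u, u * #|G : N| = 1 %[mod 'o(chi)%CF * d].
  rewrite -(chinese_modr coGN 0 1) /chinese mul0n mul1n add0n.
  by exists (egcdn #|G : N| ('o(chi)%CF * d)).1; rewrite mulnC.
have a_u g h : g \in G -> h \in G -> a g h ^+ (u * #|G : N|) = a g h.
  by move=> Gg Gh; rewrite -(expr_mod _ (a_det g h Gg Gh)) um1 expr_mod ?a_det.
have nz_a g h : g \in G -> h \in G -> a g h != 0.
  move=> Gg Gh; have : X g *m X h != 0 by rewrite unitmx_neq0 ?unitmx_mul ?uX.
  by rewrite aP // scaler_eq0 => /norP[].
have nz_mu g : g \in G -> mu g != 0.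
  move=> Gg; apply/prodf_neq0 => K GNK; have [GrK _] := rP K GNK; exact: nz_a.
pose Z g := (mu g ^+ u)^-1 *: X g.
have ZY : {in N, Z =1 Y}.
  move=> x Nx; rewrite /Z XY // /mu big1 ?expr1n ?invr1 ?scale1r // => K GNK.
  by have [GrK _] := rP K GNK; apply: aN1.
have Z_repr : mx_repr G Z.
  split=> [|g h Gg Gh]; first by rewrite ZY ?repr_mx1.
  rewrite /Z -scalemxAl -scalemxAr aP // !scalerA; congr (_ *: _).
  have Ggh := groupM Gg Gh; rewrite -invfM -exprMn -(muM g h) // exprMn invfM.
  rewrite -exprM mulnC a_u // mulrAC mulVf ?mul1r ?nz_a //.
by exists (MxRepresentation Z_repr).
Qed.

End CoprimeExtension.

Lemma extend_repr_irr (gT : finGroupType) (G N : {group gT}) (t : Iirr N) n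
    (Y : mx_representation algC N n) (Z : mx_representation algC G n) :
    N \subset G -> 'chi_t = cfRepr Y -> {in N, Z =1 Y} ->
  exists c, 'Res 'chi[G]_c = 'chi_t.
Proof.
move=> sNG chiE ZY; have ZN : 'Res[N] (cfRepr Z) = 'chi_t.
  rewrite chiE; apply/cfun_inP=> x Nx; rewrite cfResE // !cfunE Nx (subsetP sNG) //.
  by rewrite ZY.
have /irrP[c Dc] : cfRepr Z \in irr G.
  by apply: (@cfRes_irr_irr _ _ N); rewrite ?cfRepr_char ?ZN ?mem_irr.
by exists c; rewrite -Dc.
Qed.

Theorem extend_cyclic_irr (gT : finGroupType) (G N : {group gT}) (t : Iirr N) x :
    N <| G -> G \subset 'I['chi_t] -> x \in G -> (N * <[x]>)%g = G ->
  exists c, 'Res 'chi[G]_c = 'chi_t.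
Proof.
move=> nsNG IG Gx defG; have /irr_reprP[[n Y] /= irrY chiE] := mem_irr t.
rewrite chiE in IG; have [Z ZY] := cyclic_repr_extendible nsNG irrY IG Gx defG.
exact: extend_repr_irr (normal_sub nsNG) chiE ZY.
Qed.

(** An extension is determined by its determinant because |G : N| is prime to the degree, and the
    determinant of ['chi_t] has a unique extension of order prime to |G : N|. Uniqueness is what
    later makes the extension stable under outside automorphisms. *)
Theorem extend_coprime_irr (gT : finGroupType) (G N : {group gT}) (t : Iirr N) :
    N <| G -> G \subset 'I['chi_t] ->
    coprime #|G : N| ('o('chi_t)%CF * Num.truncn ('chi_t 1%g)) ->
  exists c, [/\ 'Res 'chi[G]_c = 'chi_t, 'o('chi_c)%CF = 'o('chi_t)%CF
              & forall d,
                  'Res 'chi_d = 'chi_t -> coprime #|G : N| 'o('chi_d)%CF ->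
                d = c].
Proof.
move=> nsNG IG coGN; have [sNG nNG] := andP nsNG.
have [c0 c0N] : exists c, 'Res 'chi[G]_c = 'chi_t.
  have /irr_reprP[[n Y] /= irrY chiE] := mem_irr t.
  rewrite chiE cfRepr1 natrK in IG coGN.
  have [Z ZY] := coprime_repr_extendible nsNG irrY IG coGN.
  exact: extend_repr_irr sNG chiE ZY.
set theta := 'chi_t in IG coGN c0N *; pose lambda := cfDet theta.
move: coGN; rewrite coprimeMr => /andP[co_e_th co_e_f].
have lin_lam: lambda \is a linear_char := cfDet_lin_char theta.
have IGlam: G \subset 'I[lambda].
  apply/subsetP=> y /(subsetP IG)/setIdP[nNy /eqP th_y].
  by rewrite inE nNy /= -cfDetConjg th_y.
have co_e_lam: coprime #|G : N| 'o(lambda)%CF by rewrite cfDet_order_lin.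
have [u [uNlam o_u Uu]] := extend_coprime_linear_char nsNG lin_lam IGlam co_e_lam.
have [c [cNth det_c] Uc] := extend_to_cfdet nsNG co_e_f c0N uNlam.
exists c; split=> // [|d dN co_e_d].
  have lin_u : 'chi_u \is a linear_char by rewrite -det_c cfDet_lin_char.
  by rewrite !cfDet_order_lin // -det_c in o_u.
have /irrP[v Dv] := lin_char_irr (cfDet_lin_char 'chi_d).
apply: Uc; rewrite // Dv; congr 'chi__; apply: Uu; rewrite -Dv.
  by rewrite -cfDetRes ?irr_char ?dN.
by rewrite cfDet_order_lin ?cfDet_lin_char.
Qed.

(** * Multiplicity one combined with the Clifford correspondence *)

Section CliffordOne.

Variables (gT : finGroupType) (M L S J : {group gT}) (B : {set Iirr L}).
Variables (k : Iirr L) (a : Iirr J).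
Hypotheses (nsLM : L <| M) (Bk : k \in B).
Hypothesis B_M : {in B & M, forall i g, conjg_Iirr i g \in B}.
Hypotheses (defT : (L * S)%g = 'I_M['chi_k]) (defJ : L :&: S = J).
Hypothesis IS : S \subset 'I['chi_a].
Hypothesis dual_a : {in B, forall i, '['Res[J] 'chi_i, 'chi_a] = (i == k)%:R}.

Local Notation over j := (exists2 i, i \in B & i \in irr_constt ('Res[L] 'chi_j)).

(** The Clifford correspondence over [k] moves the question to the stabilizer of [k], where
    [irr_multiplicity_one_corr] applies. Only constituents above [k] matter, because [a] lies under
    no other member of [B]. *)
Lemma irr_Clifford_one_corr (j : Iirr M) :
    k \in irr_constt ('Res[L] 'chi_j) ->
  exists s : Iirr S,
    [/\ '['Res[J] 'chi_s, 'chi_a] = '['Res[L] 'chi_j, 'chi_k],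
        forall s', a \in irr_constt ('Res[J] 'chi_s') ->
          '['Res[S] 'chi_j, 'chi_s'] = (s' == s)%:R
      & forall j', over j' -> '['Res[S] 'chi_j', 'chi_s] = (j' == j)%:R].
Proof.
move=> kj; set T := 'I_M['chi_k]%G.
have sLM := normal_sub nsLM; have nsLT : L <| T := normal_Inertia _ sLM.
have sTM : T \subset M := subsetIl _ _.
have sST : S \subset T by rewrite -[gval T]defT mulG_subr.
have sLT : L \subset T := normal_sub nsLT.
have [sJL sJS] : J \subset L /\ J \subset S by rewrite -defJ subsetIl subsetIr.
have overB j' : over j' -> {subset irr_constt ('Res[L] 'chi[M]_j') <= B}.
  case=> i Bi ij' i' i'j'; have [g Mg ->] := constt_Res_cfclass nsLM ij' i'j'.
  exact: B_M.
have [irrInd injInd imInd TInd resInd] := constt_Inertia_bijection k nsLM.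
have corr j' : k \in irr_constt ('Res[L] 'chi_j') ->
    exists2 t : Iirr T, k \in irr_constt ('Res[L] 'chi_t) & 'chi_j' = 'Ind[M] 'chi_t.
  rewrite -constt_Ind_Res -imInd => /imsetP[t kt ->].
  by exists t; [rewrite -constt_Ind_Res | rewrite cfIirrE ?irrInd].
have res_over j' s' : over j' -> a \in irr_constt ('Res[J] 'chi_s') ->
    '['Res[S] 'chi_j', 'chi_s'] =
    \sum_(t : Iirr T | (k \in irr_constt ('Res[L] 'chi_t)) && ('Ind[M] 'chi_t == 'chi_j'))
       '['Res[S] 'chi_t, 'chi_s'].
  move=> Bj' as'; rewrite -(cfResRes _ sST sTM) {1}['Res[T] 'chi_j']cfun_sum_cfdot.
  rewrite linear_sum cfdot_suml [RHS]big_mkcond; apply: eq_bigr => t _.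
  rewrite linearZ cfdotZl /=; case: (boolP (k \in _)) => [kt | k't] /=.
    have kt' : t \in irr_constt ('Ind[T] 'chi_k) by rewrite constt_Ind_Res.
    rewrite cfdot_Res_l; have /irrP[j1 ->] := irrInd t kt'.
    rewrite cfdot_irr (inj_eq irr_inj) eq_sym; case: eqP => _; first by rewrite mul1r.
    by rewrite mul0r.
  (* A constituent not above [k] cannot reach [a]: its constituents on [L] lie in [B] by stability
     and differ from [k], so [dual_a] excludes them. *)
  apply/eqP; rewrite mulf_eq0; apply/negPn/norP => -[tj' s't].
  have NtL : 'Res[L] 'chi_t \is a character by rewrite cfRes_char ?irr_char.
  have : a \in irr_constt ('Res[J] 'chi_t).
    rewrite -(cfResRes _ sJS sST); apply: constt_Res_trans as' => //.
    by rewrite cfRes_char ?irr_char.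
  rewrite irr_consttE -(cfResRes _ sJL sLT) ['Res[L] _]cfun_sum_constt.
  rewrite linear_sum cfdot_suml => /eqP[].
  rewrite big1 // => i it; rewrite linearZ cfdotZl /= dual_a.
    by case: eqP it => [-> kt|]; [rewrite kt in k't | rewrite mulr0].
  apply: (overB j' Bj'); rewrite -(cfResRes _ sLT sTM).
  by apply: constt_Res_trans it => //; rewrite cfRes_char ?irr_char.
have [t kt jE] := corr j kj; have Bj : over j by exists k.
have [|s [fs res_t s_t]] := irr_multiplicity_one_corr nsLT defT defJ (subsetIr _ _) IS _ kt.
  by rewrite dual_a ?eqxx.
have injT t' : k \in irr_constt ('Res[L] 'chi_t') -> 'Ind[M] 'chi_t' = 'chi_j -> t' = t.
  rewrite jE => kt' eq_ind; apply: injInd; try by rewrite constt_Ind_Res.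
  by rewrite /Ind_Iirr eq_ind.
have as_ : a \in irr_constt ('Res[J] 'chi_s) by rewrite irr_consttE fs.
exists s; split=> [|s' as'|j' Bj'].
- rewrite fs jE resInd ?constt_Ind_Res //.
- rewrite res_over // -res_t // (big_pred1 t) // => t' /=.
  apply/andP/eqP => [[kt' /eqP] | ->]; first exact: injT.
  by rewrite jE.
rewrite res_over //; case: eqP => [->|ne_j'j].
  rewrite (big_pred1 t) ?s_t ?eqxx // => t' /=.
  by apply/andP/eqP => [[kt' /eqP] | ->]; [apply: injT | rewrite jE].
rewrite big1 // => t' /andP[kt' /eqP ind_t']; rewrite s_t //.
by case: eqP => // t'E; case: ne_j'j; apply: irr_inj; rewrite -ind_t' t'E jE.
Qed.

End CliffordOne.

(** * Canonical lifts *)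

Section Nucleus.

Variables (gT : finGroupType) (pi : nat_pred) (G : {group gT}).
Implicit Types H K L M N S T : {group gT}.

(* The data attached to a member [i] of the canonical basis [B]: [c] is a     *)
(* pi-special character of [J] inducing ['chi_i], everything being stable     *)
(* under [W]; the last condition provides, for each pi-extension [W1] of [J], *)
(* a pi-subgroup [P] such that [c] restricted to [P :&: M] is dual to [B].    *)
Record nucleus M (B : {set Iirr M}) (i : Iirr M) (W J : {group gT}) (c : Iirr J) : Prop :=
  Nucleus {
    nucleusI : W :&: M = J;
    nucleus_inertia : (W * M)%g = 'I_G['chi_i];
    nucleus_stable : W \subset 'I['chi_c];
    nucleus_Ind : 'Ind[M] 'chi_c = 'chi_i;
    nucleus_det : pi.-nat 'o('chi_c)%CF;
    nucleus_dual : forall W1 : {group gT},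
      J \subset W1 -> W1 \subset W -> pi.-nat #|W1 : J| ->
      exists P : {group gT},
        [/\ P \subset W1, pi.-group P, (P * J)%g = W1,
            'Res[P :&: M] 'chi_c \in irr (P :&: M)
          & {in B, forall j,
               '['Res[P :&: M] 'chi_j, 'Res[P :&: M] 'chi_c] = (j == i)%:R}]
  }.

Section PiStep.

Variables (L M : {group gT}) (B : {set Iirr L}).
Hypotheses (nsLG : L <| G) (nsMG : M <| G) (sLM : L \subset M).
Hypothesis B_G : {in B & G, forall i g, conjg_Iirr i g \in B}.
Hypothesis piML : pi.-nat #|M : L|.

Let B' := [set j | [exists i in B, i \in irr_constt ('Res[L] 'chi[M]_j)]].

Let sMG : M \subset G := normal_sub nsMG.
Let sLG : L \subset G := normal_sub nsLG.
Let nsLM : L <| M := normalS sLM sMG nsLG.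
Let nMG g : g \in G -> g \in 'N(M) := subsetP (normal_norm nsMG) g.
Let nLG g : g \in G -> g \in 'N(L) := subsetP (normal_norm nsLG) g.

(** The new nucleus character is the constituent [s] of ['chi_j] above [c] on the stabilizer of
    ['chi_k] cut down to [W], and the new [W'] is the stabilizer of ['chi_j] in [W]. Applying the
    same correspondence inside the pi-subgroup attached to [k] yields duality with the characters
    above [B]. *)
Lemma pi_step_nucleus k (W J : {group gT}) (c : Iirr J) j :
    k \in B -> k \in irr_constt ('Res[L] 'chi_j) -> nucleus B k W c ->
  exists (W' J' : {group gT}) (c' : Iirr J'), nucleus B' j W' c'.
Proof.
move=> Bk kj [defJ defIk IWc Indc pi_oc dualc].
have sWG : W \subset G by apply: subset_trans (mulG_subl L W) _; rewrite defIk subsetIl.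
pose Ij := 'I_G['chi_j]%G; pose W' := (W :&: Ij)%G; pose J' := (W' :&: M)%G.
have sMIj : M \subset Ij by apply: sub_Inertia.
have sLIj := subset_trans sLM sMIj.
have sW'W : W' \subset W := subsetIl _ _.
have sW'Ij : W' \subset Ij := subsetIr _ _.
have defJ' : W :&: M = J' by rewrite /= -setIA (setIidPr sMIj).
have sJ'W' : J' \subset W' := subsetIl _ _.
have sJ'M : J' \subset M := subsetIr _ _.
have sJJ' : J \subset J' by rewrite -defJ -defJ' setIS.
have sJL : J \subset L by rewrite -defJ subsetIr.
have nsJ'W' : J' <| W'.
  by rewrite /normal sJ'W' normsI ?normG // (subset_trans sW'W) // (subset_trans sWG) ?normal_norm.
have nsJW : J <| W.
  by rewrite /normal -defJ subsetIl normsI ?normG // (subset_trans sWG) ?normal_norm.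
have nsJJ' : J <| J' := normalS sJJ' (subset_trans sJ'W' sW'W) nsJW.
pose T := 'I_M['chi_k]%G.
have defT : (L * J')%g = T.
  rewrite -defJ' group_modl // -normC ?(subset_trans sWG) ?normal_norm //.
  by rewrite defIk setIC setIA (setIidPl sMG).

(* By Frobenius reciprocity [c] is dual to the whole of Irr(L), so the correspondence may first be
   used with the full set instead of [B]. *)
have Mc i : '['Res[J] 'chi[L]_i, 'chi_c] = (i == k)%:R.
  by rewrite cfdot_Res_l Indc cfdot_irr.
have IJ'c : J' \subset 'I['chi_c] := subset_trans (subset_trans sJ'W' sW'W) IWc.
have defJ2 : L :&: J' = J.
  by rewrite -defJ' setIC -setIA (setIidPr sLM).
have [s [fs res_s]] : exists s : Iirr J',
    '['Res[J] 'chi_s, 'chi_c] = '['Res[L] 'chi_j, 'chi_k] /\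
    forall s', c \in irr_constt ('Res[J] 'chi_s') ->
      '['Res[J'] 'chi_j, 'chi_s'] = (s' == s)%:R.
  have [|||s [fs res_s _]] :=
    @irr_Clifford_one_corr _ M L J' J [set: Iirr L] k c nsLM _ _ defT defJ2 IJ'c _ j kj;
    try by exists s.
  - by rewrite inE.
  - by move=> i g _ _; rewrite inE.
  by move=> i _; apply: Mc.
have cs : c \in irr_constt ('Res[J] 'chi_s) by rewrite irr_consttE fs -irr_consttE.
have sj : s \in irr_constt ('Res[J'] 'chi_j) by rewrite irr_consttE res_s ?eqxx ?oner_eq0.
have indexT : #|J' : J| = #|T : L|.
  have := mul_cardG L J'; rewrite defT defJ2 -(Lagrange sJJ').
  have sLT : L \subset T by rewrite -[gval T]defT mulG_subl.
  rewrite -(Lagrange sLT) mulnA -[RHS]mulnA [(#|_ : _| * _)%N]mulnC mulnA.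
  by move/eqP; rewrite eqn_pmul2l ?muln_gt0 ?cardG_gt0 // => /eqP.
have pi_J'J : pi.-nat #|J' : J|.
  by rewrite indexT; apply: pnat_dvd piML; rewrite indexSg ?subsetIl // -[gval T]defT mulG_subl.
have defW' : (W' * M)%g = 'I_G['chi_j].
  apply/eqP; rewrite eqEsubset mul_subG //=.
  apply/subsetP=> g Ig; have := subsetP (Inertia_over_sub nsLG nsMG sLM kj) g Ig.
  rewrite -defIk -mulgA (mulSGid sLM) => /mulsgP[w m Ww Mm gE].
  by rewrite gE mem_mulg // in_setI Ww -(groupMr _ (subsetP sMIj m Mm)) -gE.
have IW's : W' \subset 'I['chi_s].
  apply/subsetP=> w W'w; have Ww := subsetP sW'W w W'w.
  have nJ'w : w \in 'N(J') := subsetP (normal_norm nsJ'W') w W'w.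
  have nJw : w \in 'N(J) := subsetP (normal_norm nsJW) w Ww.
  have jw : conjg_Iirr j w = j.
    by apply: irr_inj; rewrite conjg_IirrE inertiaJ //; have /setIP[] := subsetP sW'Ij w W'w.
  have cw : conjg_Iirr c w = c.
    by apply: irr_inj; rewrite conjg_IirrE inertiaJ // (subsetP IWc).
  have csw : c \in irr_constt ('Res[J] 'chi_(conjg_Iirr s w)).
    by rewrite -cw constt_Res_conjg.
  have : conjg_Iirr s w \in irr_constt ('Res[J'] 'chi_j).
    by rewrite -jw constt_Res_conjg ?nMG ?(subsetP sWG).
  rewrite irr_consttE res_s // pnatr_eq0 eqb0 negbK => /eqP sw.
  by rewrite inE nJ'w -conjg_IirrE sw eqxx.

have sJ'T : J' \subset T by rewrite -[gval T]defT mulG_subr.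
have ResJ : 'Res[J] 'chi_s = '['Res[J] 'chi_s, 'chi_c] *: 'chi_c.
  exact: cfRes_invariant_irr cs.
have [f fE] : exists f : nat, '['Res[J] 'chi_s, 'chi_c] = f%:R.
  by apply/natrP; rewrite Cnat_cfdot_char_irr ?cfRes_char ?irr_char.
(* ['chi_j] is a constituent of the induced character, so it suffices to compare degrees. *)
have Inds : 'Ind[M] 'chi_s = 'chi_j.
  apply: char_constt_eq; rewrite ?cfInd_char ?irr_char ?constt_Ind_Res //.
  have [_ _ imInd _ resInd] := constt_Inertia_bijection k nsLM.
  have := imInd j; rewrite constt_Ind_Res kj => /imsetP[t kt jE].
  have jInd : 'chi_j = 'Ind[M] 'chi_t.
    by rewrite jE cfIirrE //; case: (constt_Inertia_bijection k nsLM) => ->.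
  have k1 : 'chi_k 1%g = #|L : J|%:R * 'chi_c 1%g by rewrite -Indc cfInd1.
  have nsLT : L <| T := normal_Inertia _ sLM.
  have kt' : k \in irr_constt ('Res[L] 'chi_t) by rewrite -constt_Ind_Res.
  have resT := cfRes_invariant_irr nsLT (subsetIr _ _) kt'.
  rewrite jInd !cfInd1 ?subsetIl // -(cfRes1 J 'chi_s) ResJ -(cfRes1 L 'chi_t) resT.
  rewrite resInd // -jInd -fs fE !cfunE k1 !mulrA -!natrM; congr (_%:R * _).
  rewrite -(Lagrange_index (subsetIl M _ : T \subset M) sJ'T) -!mulnA; congr (_ * _)%N.
  rewrite mulnC; congr (_ * _)%N; apply/eqP.
  rewrite -(eqn_pmul2r (cardG_gt0 J')) mulnC Lagrange //.
  rewrite -(Lagrange (normal_sub nsLT)) -(Lagrange sJL) -(Lagrange sJJ') indexT.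
  by rewrite mulnAC mulnC mulnCA mulnA.
(* On [J] the determinant of [s] is a power of that of [c]; its ['o('chi_c)]-th power is thus a
   linear character of J'/J, a pi-group. *)
have pi_os : pi.-nat 'o('chi_s)%CF.
  have lin_s := cfDet_lin_char 'chi_s.
  pose lam := cfDet 'chi_s ^+ 'o('chi_c)%CF.
  have lin_lam : lam \is a linear_char by rewrite rpredX.
  have kerJ : J \subset cfker lam.
    rewrite -subsetIidl -cfker_Res ?lin_charW // /lam rmorphXn /= -cfDetRes ?irr_char //.
    rewrite ResJ fE scaler_nat cfDetMn ?irr_char // -exprM mulnC exprM exp_cforder.
    by rewrite expr1n cfker_cfun1.
  have : (#[cfDet 'chi_s]%CF %| 'o('chi_c)%CF * #|J' : J|)%N.
    rewrite dvdn_cforder exprM -/lam -(cfQuoK nsJJ' kerJ) -rmorphXn cfMod_eq1 //.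
    by rewrite -dvdn_cforder -card_quotient ?normal_norm // cforder_lin_char_dvdG // cfQuo_lin_char.
  by move/pnat_dvd; apply; rewrite pnatM pi_oc.
(* The pi-subgroup given for [W1] over [J] serves again over [J'], as |J' : J| = |T : L| is a
   pi-number. *)
exists W', J', s; split=> // W1 sJ'W1 sW1W' piW1.
have sJW1 := subset_trans sJJ' sJ'W1; have sW1W := subset_trans sW1W' sW'W.
have [|P [sPW1 piP defW1 irrP dualP]] := dualc W1 sJW1 sW1W.
  by rewrite -(Lagrange_index sJ'W1 sJJ') pnatM piW1.
have sPW' := subset_trans sPW1 sW1W'; have sPW := subset_trans sPW' sW'W.
pose S := (P :&: M)%G; pose J1 := (P :&: L)%G.
have sSJ' : S \subset J' by rewrite setSI.
have defJS : (J * S)%g = J'.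
  have -> : S :=: P :&: J' by rewrite setIA (setIidPl sPW').
  by rewrite group_modl // -(normC (subset_trans sPW (normal_norm nsJW))) defW1 (setIidPr sJ'W1).
pose a := cfIirr ('Res[J1] 'chi_c).
have aE : 'chi_a = 'Res[J1] 'chi_c by rewrite cfIirrE.
have sJ1J : J1 \subset J by rewrite -defJ setSI.
have nsJ1P : J1 <| P.
  by rewrite /normal subsetIl normsI ?normG // (subset_trans sPW) // (subset_trans sWG) ?normal_norm.
have IPa : P \subset 'I['chi_a].
  apply/subsetP=> x Px; have Wx := subsetP sPW x Px.
  have nJ1x := subsetP (normal_norm nsJ1P) x Px.
  rewrite inE nJ1x aE cfConjgRes_norm ?(subsetP (normal_norm nsJW)) //.
  by rewrite (inertiaJ (subsetP IWc x Wx)) eqxx.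
have ISa : S \subset 'I['chi_a] := subset_trans (subsetIl _ _) IPa.
have defT' : (L * S)%g = T by rewrite -defT -defJS mulgA (mulGSid sJL).
have defJ1 : L :&: S = J1 by rewrite setICA (setIidPl sLM).
have dual_a : {in B, forall i, '['Res[J1] 'chi_i, 'chi_a] = (i == k)%:R}.
  by move=> i Bi; rewrite aE; apply: dualP.
have B_M : {in B & M, forall i g, conjg_Iirr i g \in B}.
  by move=> i g Bi /(subsetP sMG); apply: B_G.
have [s1 [_ res_s1 dual_s1]] :=
  irr_Clifford_one_corr nsLM Bk B_M defT' defJ1 ISa dual_a kj.
have defJ1' : J :&: S = J1.
  by rewrite setICA (setIidPl (subset_trans sJJ' sJ'M)) -defJ setIA (setIidPl sPW).
have [|s2 [f2 res_s2 _]] := irr_multiplicity_one_corr nsJJ' defJS defJ1' IJ'c ISa _ cs.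
  by rewrite -aE cfnorm_irr.
have as2 : a \in irr_constt ('Res[J1] 'chi_s2) by rewrite irr_consttE f2 -irr_consttE.
(* All constituents of [s] on [S] lie above [a], since [s] restricts to a multiple of [c] on [J]; by
   multiplicity one only [s2] survives. *)
have sE : 'Res[S] 'chi_s = 'chi_s2.
  rewrite ['Res[S] 'chi_s]cfun_sum_cfdot (bigD1 s2) //= res_s2 ?eqxx ?scale1r //.
  rewrite big1 ?addr0 // => i ne_i2; have [ai | a'i] := boolP (a \in irr_constt ('Res[J1] 'chi_i)).
    by rewrite res_s2 // (negPf ne_i2) scale0r.
  apply/eqP; rewrite scaler_eq0; apply/orP; left; apply: contraR a'i => is_.
  have [b bi] := neq0_has_constt (Res_irr_neq0 J1 i).
  suff <- : b = a by [].
  have : b \in irr_constt ('Res[J1] 'chi_s).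
    rewrite -(cfResRes _ (_ : J1 \subset S) sSJ') ?setIS //.
    by apply: constt_Res_trans bi => //; rewrite cfRes_char ?irr_char.
  rewrite -(cfResRes _ sJ1J sJJ') ResJ linearZ /= -aE irr_consttE cfdotZl cfdot_irr.
  by apply: contraNeq => /negPf; rewrite eq_sym => ->; rewrite mulr0.
(* [s2] lies above [a] and under ['chi_j], so it must be the correspondent [s1] of [j]. *)
have s12 : s2 = s1.
  apply/eqP; have : s2 \in irr_constt ('Res[S] 'chi_j).
    rewrite -(cfResRes _ sSJ' sJ'M); apply: (constt_Res_trans _ sj).
      by rewrite cfRes_char ?irr_char.
    by rewrite sE constt_irr inE.
  by rewrite irr_consttE res_s1 // pnatr_eq0 eqb0 negbK.
exists P; split=> //.
- apply/eqP; rewrite eqEsubset mul_subG //=; apply: subset_trans (mulgS P sJJ').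
  by rewrite defW1.
- by rewrite -[P :&: M]/(gval S) sE mem_irr.
move=> j'; rewrite inE -[P :&: M]/(gval S) sE s12 => /exists_inP[i Bi ij'].
by apply: dual_s1; exists i.
Qed.
End PiStep.
End Nucleus.

(** * Conjugation of characters and of nuclei *)

Section Conjugation.

Variable gT : finGroupType.
Implicit Types (G H J K L M N W : {group gT}) (g : gT).

(** Transport to the conjugate group, for [g] that need not normalise [H]. *)
Definition cfJ H g (phi : 'CF(H)) : 'CF(H :^ g) := cfIsom (conj_isom H g) phi.

Lemma cfJE H g (phi : 'CF(H)) x : cfJ g phi x = phi (x ^ g^-1)%g.
Proof.
have [Hx | H'x] := boolP (x ^ g^-1 \in H)%g.
  by rewrite -{1}[x](conjgKV g) [LHS]cfIsomE.
by rewrite !cfun0 // mem_conjg.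
Qed.

Lemma cfRes_J H K g (phi : 'CF(H)) :
  K \subset H -> 'Res[K :^ g] (cfJ g phi) = cfJ g ('Res[K] phi).
Proof.
move=> sKH; apply/cfun_inP=> x; rewrite mem_conjg => Kx.
by rewrite cfResE ?conjSg ?mem_conjg // !cfJE cfResE.
Qed.

Lemma cfRes_J_norm M K g (phi : 'CF(M)) :
  K \subset M -> g \in 'N(M) -> 'Res[K :^ g] (phi ^ g)%CF = cfJ g ('Res[K] phi).
Proof.
move=> sKM nMg; apply/cfun_inP=> x; rewrite mem_conjg => Kx.
rewrite cfResE ?mem_conjg //; last by rewrite -(normP nMg) conjSg.
by rewrite cfJE cfConjgE // cfResE.
Qed.

Lemma cfInd_J_norm H M g (phi : 'CF(H)) :
    H \subset M -> g \in 'N(M) ->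
  'Ind[M] (cfJ g phi) = ('Ind[M] phi ^ g)%CF.
Proof.
move=> sHM nMg; have sHgM : H :^ g \subset M by rewrite -(normP nMg) conjSg.
apply/cfun_inP=> x Mx; rewrite cfConjgE // !cfIndE // cardJg.
congr (_ * _); rewrite (reindex_inj (conjg_inj g)) /=; apply: eq_big => y.
  by rewrite memJ_norm.
by move=> _; rewrite cfJE -{1}[x](conjgKV g) -conjJg conjgK.
Qed.

End Conjugation.

Section NucleusConjugation.

Variables (gT : finGroupType) (pi : nat_pred) (G M : {group gT}) (B : {set Iirr M}).
Hypotheses (nsMG : M <| G) (B_G : {in B & G, forall i g, conjg_Iirr i g \in B}).

(** Lets a nucleus be built for one representative of each G-orbit only. *)
Lemma nucleusJ i (W J : {group gT}) (c : Iirr J) g :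
    nucleus pi G B i W c -> g \in G ->
  nucleus pi G B (conjg_Iirr i g) (W :^ g) (isom_Iirr (conj_isom J g) c).
Proof.
case=> defJ defI IWc Indc pi_oc dualc Gg.
have nMg : g \in 'N(M) := subsetP (normal_norm nsMG) g Gg.
have cE : 'chi_(isom_Iirr (conj_isom J g) c) = cfJ g 'chi_c by rewrite isom_IirrE.
have sJM : J \subset M by rewrite -defJ subsetIr.
have sJW : J \subset W by rewrite -defJ subsetIl.
split; rewrite ?cE.
- by rewrite /= -{1}(normP nMg) -conjIg defJ.
- rewrite -{1}(normP nMg) -conjsMg defI conjIg conjGid // conjg_inertia //.
  by rewrite conjg_IirrE.
- apply/subsetP=> w; rewrite mem_conjg => Ww.
  have nJw : (w ^ g^-1)%g \in 'N(J) := subsetP (norm_inertia _) _ (subsetP IWc _ Ww).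
  have nJgw : w \in 'N(J :^ g) by rewrite -[w](conjgKV g) normJ memJ_conjg.
  rewrite inE nJgw; apply/eqP/cfun_inP=> x _; rewrite cfConjgE // !cfJE.
  have IVw : (w ^ g^-1)^-1%g \in 'I['chi_c] by rewrite groupV (subsetP IWc).
  rewrite -[RHS](inertia_valJ _ IVw) -!conjgM; congr ('chi_c (x ^ _)%g).
  by rewrite conjgE !invMg !invgK !mulgA mulVg mul1g.
- by rewrite cfInd_J_norm // Indc conjg_IirrE.
- by rewrite /cfDet_order /cfJ cfDetIsom cforder_isom.
move=> W1 sJgW1 sW1Wg piW1.
have [|||P [sPW1 piP defW1 irrP dualP]] := dualc (W1 :^ g^-1)%G.
- by rewrite -sub_conjg.
- by rewrite sub_conjgV.
- by rewrite -(indexJg _ _ g) /= conjsgKV.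
have sPJ : P :&: M \subset J.
  by rewrite -defJ setSI // (subset_trans sPW1) // sub_conjgV.
have defP : P :^ g :&: M = (P :&: M) :^ g by rewrite conjIg (normP nMg).
exists (P :^ g)%G; split.
- by rewrite sub_conjg.
- by rewrite pgroupJ.
- by rewrite -conjsMg defW1 conjsgKV.
- by rewrite /= defP cfRes_J // cfIsom_irr.
move=> j Bj; rewrite /= defP cfRes_J //.
have -> : j = conjg_Iirr (conjg_Iirr j g^-1) g by rewrite conjg_IirrKV.
rewrite conjg_IirrE cfRes_J_norm ?subsetIr // cfIsom_iso (inj_eq (@conjg_Iirr_inj _ _ g)).
by apply: dualP; rewrite B_G ?groupV.
Qed.
End NucleusConjugation.

Lemma inertia_Res_sub (gT : finGroupType) (P K J : {group gT}) (phi : 'CF(J)) :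
  P \subset 'I[phi] -> P \subset 'N(K) -> P \subset 'I['Res[K] phi].
Proof.
move=> IP nKP; rewrite -{1}(setIidPl IP); apply: subset_trans (subsetIr P _).
exact: sub_inertia_Res.
Qed.

(** * Canonical bases and their dual functions *)

Section Basis.

Variables (gT : finGroupType) (pi : nat_pred) (G : {group gT}).
Implicit Types (H J K L M N P W C : {group gT}).

(** Dual form of the assertion that the restrictions of [B] span the class functions on
    pi-elements. *)
Definition pi_spanning M (B : {set Iirr M}) :=
  forall f, f \in 'CF(M, pi_elements pi M) ->
  {in B, forall i, '[f, 'chi_i] = 0} -> f = 0.

(** Linear independence on pi-elements is not a field: it follows from the dual functions that the
    nuclei provide. *)
Record fong_basis M (B : {set Iirr M}) : Prop := FongBasis {
  fong_conj : {in B & G, forall i g, conjg_Iirr i g \in B};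
  fong_span : pi_spanning B;
  fong_nucleus : {in B, forall i,
    exists (W J : {group gT}) (c : Iirr J), nucleus pi G B i W c}
}.

Lemma cfInd_pi_group M P (phi : 'CF(P)) :
  P \subset M -> pi.-group P -> 'Ind[M] phi \in 'CF(M, pi_elements pi M).
Proof.
move=> sPM piP; apply: cfun_onS (cfInd_on sPM (cfun_onG phi)).
apply/subsetP=> _ /imset2P[x y Px My ->]; have Mx := subsetP sPM x Px.
rewrite inE groupJ //=.
by rewrite p_eltJ (mem_p_elt piP).
Qed.

(** The case W1 = J of [nucleus_dual]: inducing from a pi-subgroup gives a character vanishing off
    the pi-elements, and Frobenius reciprocity turns the duality on [P] into duality on [M]. *)
Lemma nucleus_projective M (B : {set Iirr M}) i W J (c : Iirr J) :
    nucleus pi G B i W c ->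
  exists F : 'CF(M), [/\ F \in 'CF(M, pi_elements pi M), F \is a character
    & {in B, forall j, '[F, 'chi_j] = (j == i)%:R}].
Proof.
case=> defJ _ _ _ _ dualc; have sJW : J \subset W by rewrite -defJ subsetIl.
have [|P [sPJ piP _ irrP dualP]] := dualc J (subxx J) sJW; first by rewrite indexgg.
exists ('Ind[M] ('Res[P :&: M] 'chi_c)); split=> [||j Bj].
- by rewrite cfInd_pi_group ?subsetIr // (pgroupS (subsetIl _ _) piP).
- by rewrite cfInd_char ?cfRes_char ?irr_char.
by rewrite -cfdot_Res_r cfdotC_char ?dualP ?cfRes_char ?irr_char.
Qed.

Lemma fong_basis_dual M (B : {set Iirr M}) : fong_basis B ->
  exists F : Iirr M -> 'CF(M), {in B, forall i,
    [/\ F i \in 'CF(M, pi_elements pi M), F i \is a character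
      & {in B, forall j, '[F i, 'chi_j] = (j == i)%:R}]}.
Proof.
case=> _ _ nucB; suff /fin_all_exists[F FP] (i : Iirr M) : exists F : 'CF(M), i \in B ->
    [/\ F \in 'CF(M, pi_elements pi M), F \is a character
      & {in B, forall j, '[F, 'chi_j] = (j == i)%:R}] by exists F.
have [Bi | _] := boolP (i \in B); last by exists 0.
have [W [J [c nuc]]] := nucB i Bi; have [F FP] := nucleus_projective nuc.
by exists F.
Qed.

(** [W :&: C] is a pi-extension of [J], and its pi-subgroup [P] supplements [L] in [C]. The
    character of [P] matched with [j] induces to the required dual function. Here the nucleus is
    used with W1 larger than [J]. *)
Lemma nucleus_cyclic_dual L C (B : {set Iirr L}) k W J (c : Iirr J) :
    nucleus pi G B k W c -> k \in B -> L <| C -> C \subset 'I_G['chi_k] ->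
    pi.-nat #|C : L| -> {in B & C, forall i g, conjg_Iirr i g \in B} ->
  forall j, k \in irr_constt ('Res[L] 'chi[C]_j) ->
  exists2 F, F \in 'CF(C, pi_elements pi C) &
    forall j', (exists2 i, i \in B & i \in irr_constt ('Res[L] 'chi[C]_j')) ->
      '['chi_j', F] = (j' == j)%:R.
Proof.
case=> defJ defI IWc Indc _ dualc Bk nsLC sCI piCL B_C j kj.
have [sCG sCIk] : C \subset G /\ C \subset 'I['chi_k] by apply/andP; rewrite -subsetI.
have [sLC nLC] := andP nsLC.
pose W1 := (W :&: C)%G.
have sJW : J \subset W by rewrite -defJ subsetIl.
have sJL : J \subset L by rewrite -defJ subsetIr.
have sJW1 : J \subset W1 by rewrite subsetI sJW (subset_trans sJL).
have defC : (W1 * L)%g = C.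
  by rewrite /= setIC group_modr // defI (setIidPl sCI).
have defJ1 : W1 :&: L = J by rewrite /= -setIA [C :&: L]setIC (setIidPl sLC).
have piW1J : pi.-nat #|W1 : J|.
  rewrite -defJ1 indexgI; suff -> : #|W1 : L| = #|C : L| by [].
  apply/eqP; rewrite -(eqn_pmul2r (cardG_gt0 L)) LagrangeMr defC.
  by rewrite -(Lagrange sLC) mulnC.
have [P [sPW1 piP defW1 irrP dualP]] := dualc W1 sJW1 (subsetIl _ _) piW1J.
have nLP : P \subset 'N(L).
  by rewrite (subset_trans sPW1) // (subset_trans (subsetIr _ _)).
have defLP : (L * P)%g = 'I_C['chi_k].
  by rewrite (setIidPl sCIk) -defC -defW1 -mulgA (mulSGid sJL) (normC nLP).
have sPC : P \subset C := subset_trans sPW1 (subsetIr _ _).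
have sPW : P \subset W := subset_trans sPW1 (subsetIl _ _).
pose a := cfIirr ('Res[P :&: L] 'chi_c).
have aE : 'chi_a = 'Res[P :&: L] 'chi_c by rewrite cfIirrE.
have IPa : P \subset 'I['chi_a].
  rewrite aE; apply: inertia_Res_sub; first exact: subset_trans sPW IWc.
  by rewrite normsI ?normG.
have dual_a : {in B, forall i, '['Res[P :&: L] 'chi_i, 'chi_a] = (i == k)%:R}.
  by move=> i Bi; rewrite aE; apply: dualP.
have [s [_ _ dual_s]] :=
  irr_Clifford_one_corr nsLC Bk B_C defLP (setIC L P) IPa dual_a kj.
exists ('Ind[C] 'chi_s); first by rewrite cfInd_pi_group.
by move=> j' Bj'; rewrite -cfdot_Res_l dual_s.
Qed.

End Basis.

Lemma card_pairs1 (T U : finType) (P : T -> U -> bool) :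
  #|[set u : T * U | P u.1 u.2]| = (\sum_y #|[set l | P y l]|)%N.
Proof.
rewrite -sum1_card (eq_bigl (fun u : T * U => true && P u.1 u.2)); last first.
  by move=> u; rewrite inE.
rewrite -(pair_big_dep xpredT P (fun _ _ => 1%N)) /=; apply: eq_bigr => y _.
by rewrite -sum1_card; apply: eq_bigl => l; rewrite inE.
Qed.

Lemma card_pairs2 (T U : finType) (P : T -> U -> bool) :
  #|[set u : T * U | P u.1 u.2]| = (\sum_l #|[set y | P y l]|)%N.
Proof.
rewrite card_pairs1; under eq_bigr do rewrite -sum1_card big_mkcond.
rewrite exchange_big; apply: eq_bigr => l _; rewrite -sum1_card [RHS]big_mkcond.
by apply: eq_bigr => y _; rewrite !inE.
Qed.

(** * Counting pi-elements in a coset *)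

Section CosetCount.

Variables (gT : finGroupType) (pi : nat_pred) (L C : {group gT}) (x : gT).
Hypotheses (nsLC : L <| C) (Cx : x \in C) (defC : (L * <[x]>)%g = C).
Hypothesis piCL : pi.-nat #|C : L|.

Let sLC : L \subset C := normal_sub nsLC.
Let nLC : C \subset 'N(L) := normal_norm nsLC.

Definition coset_of_elt := [set y in C | coset L y == coset L x].
Local Notation X := coset_of_elt.

Lemma coset_of_eltP y : reflect (exists2 z, z \in L & y = (x * z)%g) (y \in X).
Proof.
have nLx := subsetP nLC x Cx.
rewrite inE; apply: (iffP andP) => [[Cy /eqP eq_yx] | [z Lz ->]].
  have nLy := subsetP nLC y Cy.
  exists (x^-1 * y)%g; last by rewrite mulKVg.
  apply: coset_idr; first by rewrite groupM ?groupV.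
  by rewrite morphM ?groupV // morphV //= eq_yx mulVg.
by rewrite groupM ?(subsetP sLC z Lz) // coset_kerr.
Qed.

(* [(y, c) |-> (y c_pi', c_pi)] is a bijection, with inverse                  *)
(* [(y, c) |-> (y_pi, c y_pi')].                                              *)
Lemma card_commuting_pairs :
  #|[set u : gT * gT | [&& u.1 \in X, pi.-elt u.1 & u.2 \in 'C_L[u.1]]]| =
  #|[set u : gT * gT | [&& u.1 \in X, pi.-elt u.2 & u.2 \in 'C_L[u.1]]]|.
Proof.
set X1 := finset _; set X2 := finset _.
pose f (u : gT * gT) := ((u.1 * u.2.`_pi^')%g, u.2.`_pi).
pose g (u : gT * gT) := (u.1.`_pi, (u.2 * u.1.`_pi^')%g).
have kill p (y : gT) : p^'.-elt y -> y.`_p = 1%g by move/constt1P.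
have piN (y : gT) : pi.-elt y -> pi^'^'.-elt y by rewrite /p_elt pnatNK.
have Lp' y : y \in C -> y.`_pi^' \in L.
  move=> Cy; have nLy := subsetP nLC y Cy; apply: coset_idr; first exact: groupX.
  rewrite morph_constt //; apply/constt1P; rewrite /p_elt pnatNK.
  by apply: mem_p_elt (mem_quotient L Cy); rewrite /pgroup card_quotient.
have fP u : u \in X1 -> f u \in X2 /\ g (f u) = u.
  case: u => y c; rewrite in_set /= => /and3P[/setIdP[Cy cosy] piy /setIP[Lc /cent1P cyc]].
  have cyX i : commute y (c ^+ i) by apply: commuteX; apply: commute_sym.
  have Lcp p : c.`_p \in L by rewrite groupX.
  have Ccp p : c.`_p \in C by apply: (subsetP sLC).
  split.
    rewrite in_set /= p_elt_constt in_set groupM //= coset_kerr // cosy /=.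
    apply/setIP; split=> //.
    by apply/cent1P; apply: commuteM; [apply/commute_sym/cyX | apply: commuteX2].
  rewrite /g /f /= !(consttM _ (cyX _)) (constt_p_elt piy) (constt_p_elt (p_elt_constt _ _)).
  rewrite (kill pi c.`_pi^') ?p_elt_constt // (kill pi^' y) ?piN // mulg1 mul1g.
  by rewrite consttC.
have gP u : u \in X2 -> g u \in X1 /\ f (g u) = u.
  case: u => y c; rewrite in_set /= => /and3P[/setIdP[Cy cosy] pic /setIP[Lc /cent1P cyc]].
  have cyX i : commute c (y ^+ i) by apply: commuteX.
  have Cyp p : y.`_p \in C by rewrite groupX.
  have nLyp p : y.`_p \in 'N(L) by apply: (subsetP nLC).
  split.
    rewrite in_set /= p_elt_constt in_set Cyp -(eqP cosy) -{2}(consttC pi y).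
    rewrite coset_kerr ?Lp' // eqxx /=; apply/setIP; split; first by rewrite groupM ?Lp'.
    by apply/cent1P/commute_sym; apply: commuteM; [apply/commute_sym/cyX | apply: commuteX2].
  rewrite /f /g /= !(consttM _ (cyX _)) (constt_p_elt pic) (constt_p_elt (p_elt_constt _ _)).
  rewrite (kill pi y.`_pi^') ?p_elt_constt // (kill pi^' c) ?piN // mulg1 mul1g.
  by rewrite consttC.
apply/eqP; rewrite eqn_leq; apply/andP; split.
  rewrite -(card_in_imset (can_in_inj (fun u X1u => (fP u X1u).2))).
  by apply/subset_leq_card/subsetP=> _ /imsetP[u /fP[X2u _] ->].
rewrite -(card_in_imset (can_in_inj (fun u X2u => (gP u X2u).2))).
by apply/subset_leq_card/subsetP=> _ /imsetP[u /gP[X1u _] ->].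
Qed.

Section Invariant.

Variables (B : {set Iirr L}) (F : Iirr L -> 'CF(L)).
Hypothesis B_C : {in B & C, forall i g, conjg_Iirr i g \in B}.
Hypothesis spanB : pi_spanning pi B.
Hypothesis dualF : {in B, forall i, F i \in 'CF(L, pi_elements pi L)
    /\ {in B, forall j, '[F i, 'chi_j] = (j == i)%:R}}.

Lemma pi_spanning_sum f : f \in 'CF(L, pi_elements pi L) ->
  f = \sum_(i in B) '[f, 'chi_i] *: F i.
Proof.
move=> pif; apply/eqP; rewrite -subr_eq0; apply/eqP/spanB => [|j Bj].
  rewrite rpredB ?rpred_sum // => i /dualF[piF _]; exact: rpredZ.
rewrite cfdotBl cfdot_suml (bigD1 j) //= cfdotZl (dualF Bj).2 // eqxx mulr1.
rewrite big1 ?addr0 ?subrr // => i /andP[Bi ne_ij].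
by rewrite cfdotZl (dualF Bi).2 // eq_sym (negPf ne_ij) mulr0.
Qed.

(** Analogue of the second orthogonality relation, obtained by expanding the indicator of the class
    of [v] in the dual basis. *)
Lemma pi_kernel u v : v \in L -> pi.-elt v ->
  \sum_(i in B) F i u * ('chi_i v)^* = #|'C_L[v]|%:R *+ (u \in v ^: L).
Proof.
move=> Lv piv; have pi_vL : '1_(v ^: L) \in 'CF(L, pi_elements pi L).
  apply: cfun_onS (cfuni_on L _); apply/subsetP=> _ /imsetP[z Lz ->].
  by rewrite inE groupJ // p_eltJ.
have dotv i : '['1_(v ^: L), 'chi[L]_i] = (#|'C_L[v]|%:R)^-1 * ('chi_i v)^*.
  rewrite (cfdotEl _ (cfuni_on L _)).
  rewrite (eq_bigr (fun _ => ('chi_i v)^*)) => [|_ /imsetP[z Lz ->]]; last first.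
    by rewrite cfun_classE Lv memJ_class // mul1r cfunJ.
  rewrite sumr_const -index_cent1 -[_ *+ #|L : _|]mulr_natl mulrA; congr (_ * _).
  by rewrite natf_indexg ?subsetIl // mulrA mulVf ?neq0CG ?mul1r.
have /cfunP/(_ u) := pi_spanning_sum pi_vL.
rewrite cfun_classE Lv sum_cfunE /= => /(congr1 (fun z => #|'C_L[v]|%:R * z)).
rewrite mulr_natr mulr_sumr => ->; apply: eq_bigr => i _.
by rewrite cfunE dotv mulrA mulVKf ?neq0CG // mulrC.
Qed.

(** x z commutes with l exactly when z conjugates l^x to l, so the solutions, if any, form a coset
    of the centralizer of l^x. *)
Lemma card_coset_commute l : l \in L ->
  #|[set y | (y \in X) && (l \in 'C_L[y])]| =
  ((l \in (l ^ x) ^: L)%g * #|'C_L[l ^ x]|)%N.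
Proof.
move=> Ll; set v := (l ^ x)%g.
have commE z : z \in L -> (l \in 'C_L[x * z]) = ((v ^ z)%g == l).
  move=> Lz; rewrite inE Ll /= /v -conjgM.
  by apply/cent1P/eqP => [|]; [move/commgP/conjg_fixP | move/conjg_fixP/commgP].
have [ | l'v] := boolP (l \in v ^: L); last first.
  apply: eq_card0 => y; rewrite inE; apply/negP => /andP[/coset_of_eltP[z Lz ->]].
  by rewrite commE // => /eqP lE; case/negP: l'v; rewrite -lE memJ_class.
case/imsetP=> z0 Lz0 lE; rewrite mul1n -(card_rcoset 'C_L[v] z0) -(card_lcoset ('C_L[v] :* z0) x).
apply: eq_card => y; rewrite in_set; apply/andP/lcosetP => [[/coset_of_eltP[z Lz ->]]|].
  rewrite commE // => /eqP vz; exists z => //; rewrite mem_rcoset inE groupM ?groupV //=.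
  by apply/cent1P/commute_sym/commgP/conjg_fixP; rewrite conjgM vz lE conjgK.
case=> z; rewrite mem_rcoset => /setIP[Lzz0 czz0] ->.
have Lz : z \in L by rewrite -(groupMr _ (groupVr Lz0)).
split; first by apply/coset_of_eltP; exists z.
rewrite commE // -[z](mulgKV z0) conjgM lE; apply/eqP; congr (_ ^ _)%g.
by apply/conjg_fixP/commgP/commute_sym/cent1P.
Qed.

(** Brauer's permutation argument: the number of members of [B] fixed by x is the trace of x in this
    basis, computed with the dual functions and then evaluated by [pi_kernel]. *)
Lemma card_invariant :
  (#|[set i in B | C \subset 'I['chi_i]]| * #|L| =
   #|[set u : gT * gT | [&& u.1 \in X, pi.-elt u.2 & u.2 \in 'C_L[u.1]]]|)%N.
Proof.
have nLx := subsetP nLC x Cx.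
have inv_x (i : Iirr L) : (C \subset 'I['chi_i]) = (conjg_Iirr i x^-1 == i).
  apply/idP/eqP => [CI | xi].
    by apply: irr_inj; rewrite conjg_IirrE inertiaJ // groupV (subsetP CI).
  rewrite -defC mulG_subG; apply/andP. split; first exact: sub_inertia.
  rewrite cycle_subG -groupV; apply/setIdP; split; first by rewrite groupV.
  by rewrite -conjg_IirrE xi.
apply/eqP; rewrite -(eqr_nat algC) natrM.
rewrite (card_pairs2 (fun y l => [&& y \in X, pi.-elt l & l \in 'C_L[y]])); apply/eqP.
have -> : #|[set i in B | C \subset 'I['chi_i]]|%:R =
    \sum_(i in B) '[F i, 'chi_(conjg_Iirr i x^-1)].
  rewrite -sum1_card natr_sum.
  rewrite (eq_bigl (fun i => (i \in B) && (C \subset 'I['chi_i]))); last by move=> i; rewrite inE.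
  rewrite big_mkcondr; apply: eq_bigr => i Bi.
  by rewrite (dualF Bi).2 ?B_C ?groupV // inv_x; case: eqP.
rewrite mulr_suml natr_sum.
transitivity (\sum_(i in B) \sum_(l in L) F i l * ('chi_i (l ^ x)%g)^*).
  apply: eq_bigr => i Bi; rewrite cfdotE mulrAC mulVf ?neq0CG ?mul1r //.
  by apply: eq_bigr => l Ll; rewrite conjg_IirrE cfConjgE ?groupV ?invgK.
rewrite exchange_big big_mkcond; apply: eq_bigr => l _; case: ifP => Ll; last first.
  rewrite (eq_card0 (A := [set _ | _])) // => y.
  by rewrite !inE Ll !andbF.
have [pil | pi'l] := boolP (pi.-elt l).
  rewrite pi_kernel ?p_eltJ ?memJ_norm //.
  transitivity (((l \in (l ^ x) ^: L)%g * #|'C_L[l ^ x]|)%:R : algC).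
    by case: (l \in _); rewrite ?mul1n ?mul0n.
  rewrite -card_coset_commute //.
rewrite big1 => [|i Bi]; last first.
  by rewrite (cfun_on0 (dualF Bi).1) ?mul0r // inE Ll.
by rewrite (eq_card0 (A := [set _ | _])) // => y; rewrite !inE !andbF.
Qed.

Let A := [set y in X | pi.-elt y].

Let defCL : (C / L)%g = <[coset L x]>%g.
Proof. by rewrite -defC quotientMidl quotient_cycle ?(subsetP nLC). Qed.

Let abCL : abelian (C / L).
Proof. by rewrite defCL cycle_abelian. Qed.

Lemma coset_of_elt_J y z : y \in X -> z \in C -> (y ^ z)%g \in X.
Proof.
case/setIdP=> Cy /eqP cosy Cz; rewrite inE groupJ //=.
have [nLy nLz] := (subsetP nLC y Cy, subsetP nLC z Cz).
rewrite morphJ //= -cosy; apply/eqP/conjg_fixP/commgP.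
by apply: (centsP abCL); apply: mem_quotient.
Qed.

Let nsAC : A <| C.
Proof.
apply/andP; split; first by apply/subsetP=> y /setIdP[/setIdP[]].
apply/subsetP=> z Cz; rewrite inE; apply/subsetP=> _ /imsetP[y /setIdP[Xy piy] ->].
by rewrite inE coset_of_elt_J ?p_eltJ.
Qed.

Lemma card_coset_classes :
  (#|classes C ::&: A| * #|L| =
   #|[set u : gT * gT | [&& u.1 \in X, pi.-elt u.1 & u.2 \in 'C_L[u.1]]]|)%N.
Proof.
apply/eqP; rewrite -(eqr_nat algC) natrM; apply/eqP.
rewrite (card_pairs1 (fun y l => [&& y \in X, pi.-elt y & l \in 'C_L[y]])) natr_sum.
pose h y : algC := (y \in A)%:R * #|'C_L[y]|%:R.
have AJ y z : z \in C -> (y ^ z \in A)%g = (y \in A).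
  by move=> Cz; rewrite memJ_norm // (subsetP (normal_norm nsAC)).
transitivity (\sum_(y in C) h y); last first.
  rewrite big_mkcond; apply: eq_bigr => y _; rewrite /h.
  have [Ay | A'y] := boolP (y \in A).
    have /setIdP[Xy piy] := Ay; have /setIdP[Cy _] := Xy; rewrite Cy mul1r.
    by congr _%:R; apply: eq_card => l; rewrite inE Xy piy.
  rewrite mul0r if_same eq_card0 // => l; rewrite inE.
  by move: A'y; rewrite inE; case: (y \in X) => //= /negPf->.
rewrite sum_by_classes => [|y z Cy Cz]; last first.
  rewrite /h AJ //; congr (_ * _%:R).
  by rewrite cent1J -{1}(normsP nLC z Cz) -conjIg cardJg.
rewrite -sum1_card natr_sum mulr_suml.
rewrite (eq_bigl (fun K => (K \in classes C) && (K \subset A))) => [|K]; last by rewrite inE.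
rewrite big_mkcondr; apply: eq_bigr => _ /imsetP[y0 Cy0 ->].
have [z Cz ->] := repr_class C y0; set y := (y0 ^ z)%g.
have Cy : y \in C by rewrite groupJ.
have -> : (y0 ^: C)%g = (y ^: C)%g by rewrite classGidl.
have -> : (y ^: C \subset A)%g = (y \in A).
  by rewrite class_sub_norm // normal_norm.
rewrite /h; case: (boolP (y \in A)) => [Ay | _]; last by rewrite mul0r mulr0.
rewrite !mul1r -natrM; congr _%:R; rewrite -index_cent1.
have /setIdP[/setIdP[_ /eqP cosy] _] := Ay.
(* An element of the coset generates C/L, so its centralizer covers C/L and its C-class has as many
   elements as its L-class. *)
have defC' : (L * 'C_C[y])%g = C.
  apply/eqP; rewrite eqEsubset mul_subG ?subsetIl //= -quotientSK //.
  by rewrite defCL -cosy cycle_subG mem_quotient // inE Cy cent1id.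
apply/eqP; rewrite -(eqn_pmul2l (cardG_gt0 'C_C[y])) mulnA Lagrange ?subsetIl //.
have := mul_cardG L 'C_C[y]; rewrite defC' setIA (setIidPl sLC) => <-.
by rewrite mulnC.
Qed.

Hypothesis dualC : forall i, i \in B -> C \subset 'I['chi_i] ->
  forall j, i \in irr_constt ('Res[L] 'chi[C]_j) ->
  exists2 F, F \in 'CF(C, pi_elements pi C) &
    forall j', (exists2 k, k \in B & k \in irr_constt ('Res[L] 'chi[C]_j')) ->
      '['chi_j', F] = (j' == j)%:R.

(** Extend each C-invariant member of [B] to [C] and cut it down to the pi-elements of the coset.
    These functions are independent by [dualC], and the two counts above say there are enough of
    them to span; [f] on the coset is orthogonal to all of them. *)
Lemma coset_spanning f :
    f \in 'CF(C, pi_elements pi C) ->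
    (forall j, (exists2 i, i \in B & i \in irr_constt ('Res[L] 'chi[C]_j)) ->
       '[f, 'chi_j] = 0) ->
  {in A, forall y, f y = 0}.
Proof.
move=> pif orth_f.
pose Binv := [set i in B | C \subset 'I['chi_i]].
have ext i : exists j : Iirr C, i \in Binv -> 'Res[L] 'chi_j = 'chi_i.
  have [/setIdP[_ IC] | _] := boolP (i \in Binv); last by exists 0.
  by have [j jE] := extend_cyclic_irr nsLC IC Cx defC; exists j.
have {ext} [e eP] := fin_all_exists ext.
have eO i : i \in Binv -> i \in irr_constt ('Res[L] 'chi_(e i)).
  by move=> Bi; rewrite eP // constt_irr inE.
have dual i : exists F' : 'CF(C), i \in Binv -> F' \in 'CF(C, pi_elements pi C) /\
    forall j', (exists2 k, k \in B & k \in irr_constt ('Res[L] 'chi[C]_j')) ->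
      '['chi_j', F'] = (j' == e i)%:R.
  have [Bi | _] := boolP (i \in Binv); last by exists 0.
  have /setIdP[Bi' IC] := Bi; have [F' pF' dF'] := dualC Bi' IC (eO i Bi).
  by exists F'.
have {dual} [F' F'P] := fin_all_exists dual.
pose q : 'CF(C / L) := '1_[set coset L x].
have qE K : K \in (C / L)%g -> q K = (K == coset L x)%:R.
  move=> GK; rewrite cfuniE ?inE // /normal sub1set mem_quotient //=.
  by apply/cents_norm/(subset_trans abCL)/centS; rewrite sub1set mem_quotient.
(* The indicator of the coset, inflated from the abelian group C/L, is a combination of linear
   characters trivial on [L]; multiplying an extension of ['chi_i] by it stays within characters
   above [i]. *)
pose u : 'CF(C) := (q %% L)%CF.
have uE y : y \in C -> u y = (y \in X)%:R.
  by move=> Cy; rewrite cfModE // qE ?mem_quotient // inE Cy.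
have u_sum : u = \sum_b '[q, 'chi_b] *: ('chi_b %% L)%CF.
  by rewrite /u {1}[q]cfun_sum_cfdot linear_sum; apply: eq_bigr => b _; rewrite linearZ.
have lin_b (b : Iirr (C / L)) : ('chi_b %% L)%CF \is a linear_char.
  by rewrite cfMod_lin_char //; apply/char_abelianP.
have mul_b i xi : i \in Binv -> xi \is a linear_char -> 'Res[L] xi = 1 ->
    exists2 j, 'chi_j = xi * 'chi_(e i) & i \in irr_constt ('Res[L] 'chi_j).
  move=> Bi lin_xi xiL; have /irrP[j jE] : xi * 'chi_(e i) \in irr C.
    by rewrite mul_lin_irr ?mem_irr.
  by exists j; rewrite -?jE // rmorphM /= xiL mul1r eO.
have bL (b : Iirr (C / L)) : 'Res[L] ('chi_b %% L)%CF = 1.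
  apply/cfun_inP=> l Ll; rewrite cfResE // cfModE ?(subsetP sLC) // coset_id //.
  by rewrite cfun1E Ll lin_char1 //; apply/char_abelianP.
pose v i : 'CF(C) := 'chi_(e i) * '1_A.
have vA i : v i \in 'CF(C, A) by apply: mul_cfuni_on.
have AE y : ('1_A : 'CF(C)) y = (y \in A)%:R by rewrite cfuniE.
have fv i : i \in Binv -> '[f * '1_A, v i] = 0.
  move=> Bi; transitivity '[f * u, 'chi_(e i)].
    rewrite !cfdotE; congr (_ * _); apply: eq_bigr => y Cy; rewrite !cfunE AE uE // inE.
    case: (y \in X); last by rewrite !mulr0 !mul0r.
    have [_ | pi'y] := boolP (pi.-elt y); first by rewrite !mulr1.
    by rewrite (cfun_on0 pif) ?mul0r // inE Cy.
  rewrite u_sum mulr_sumr cfdot_suml big1 // => b _.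
  rewrite -scalerAr cfdotZl; apply/eqP; rewrite mulf_eq0; apply/orP; right.
  have [||j jE ij] := mul_b i ('chi_b %% L)^*%CF Bi; first by rewrite cfConjC_lin_char.
    by rewrite -cfAutRes bL cfConjC_cfun1.
  apply/eqP; rewrite -(orth_f j); last by exists i => //; case/setIdP: Bi.
  rewrite jE !cfdotE; congr (_ * _); apply: eq_bigr => y _.
  by rewrite !cfunE rmorphM /= conjCK -mulrA.
have vF i j : i \in Binv -> j \in Binv -> '[v i, F' j] = '[q, 'chi_0] *+ (i == j).
  move=> Bi Bj; have [pF' dF'] := F'P j Bj.
  transitivity '['chi_(e i) * u, F' j].
    apply: (eq_cfdotl pF') => y /setIdP[Cy piy].
    by rewrite !cfunE AE uE // [y \in A]inE piy andbT.
  have [irr_m inj_m _ _] := constt_Ind_ext nsLC (eP i Bi).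
  have mE (b : Iirr (C / L)) : 'chi_(mul_mod_Iirr (e i) b) = ('chi_b %% L)%CF * 'chi_(e i).
    by rewrite cfIirrE ?irr_m // mod_IirrE.
  have mL (b : Iirr (C / L)) : 'Res[L] 'chi_(mul_mod_Iirr (e i) b) = 'chi_i.
    by rewrite mE rmorphM /= bL mul1r eP.
  have m0 : mul_mod_Iirr (e i) (0 : Iirr (C / L)) = e i.
    by apply: irr_inj; rewrite mE irr0 rmorph1 mul1r.
  rewrite u_sum mulr_sumr cfdot_suml.
  transitivity (\sum_b '[q, 'chi_b] * (mul_mod_Iirr (e i) b == e j)%:R).
    apply: eq_bigr => b _; rewrite -scalerAr cfdotZl ['chi_(e i) * _]mulrC -mE dF' //.
    by exists i; [case/setIdP: Bi | rewrite mL constt_irr inE].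
  have [<-{j Bj pF' dF'} | ne_ij] := eqVneq i j.
    rewrite (bigD1 0) //= m0 eqxx mulr1 big1 ?addr0 // => b nz_b.
    case: eqP => [mb|]; last by rewrite mulr0.
    by case/eqP: nz_b; apply: inj_m; rewrite mb m0.
  rewrite big1 // => b _; case: eqP => [mb|]; last by rewrite mulr0.
  by case/eqP: ne_ij; apply: irr_inj; rewrite -(mL b) mb eP.
have nz_q : '[q, 'chi_0] != 0.
  rewrite (cfdotEl _ (cfuni_on _ _)) big_set1 qE ?mem_quotient // eqxx mul1r irr0.
  by rewrite cfun1E mem_quotient // conjC1 mulr1 invr_eq0 neq0CG.
pose X0 := [tuple v (enum_val t) | t < #|Binv|].
have BX t : enum_val t \in Binv := enum_valP t.
have freeX : free X0.
  have XE (s : 'I_#|Binv|) : X0`_s = v (enum_val s) by rewrite -tnth_nth tnth_mktuple.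
  apply/freeP=> k k0 t; have := congr1 (fun g => '[g, F' (enum_val t)]) k0.
  rewrite cfdot0l cfdot_suml (bigD1 t) // XE cfdotZl vF ?BX // eqxx mulr1n.
  rewrite big1 => [/eqP|t' ne_t't].
    by rewrite /= addr0 mulf_eq0 (negPf nz_q) orbF => /eqP.
  by rewrite XE cfdotZl vF ?BX // (inj_eq enum_val_inj) (negPf ne_t't) mulr0.
have spanX : <<X0>>%VS = 'CF(C, A)%VS.
  apply/eqP; rewrite eqEdim (eqnP freeX) size_tuple dim_cfun_on; apply/andP; split.
    by apply/span_subvP=> _ /mapP[t _ ->]; apply: vA.
  rewrite -(leq_pmul2r (cardG_gt0 L)) card_coset_classes card_commuting_pairs.
  by rewrite -card_invariant.
move=> y Ay.
have : f * '1_A = 0.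
  apply/eqP; rewrite -cfnorm_eq0; apply/eqP.
  have fX : f * '1_A \in <<X0>>%VS by rewrite spanX mul_cfuni_on.
  apply: (@span_orthogonal _ _ [:: f * '1_A] X0) fX; last by rewrite span_seq1 memv_line.
  by apply/orthoPl=> _ /mapP[t _ ->]; apply: fv.
by move/cfunP/(_ y); rewrite !cfunE cfuniE // Ay mulr1 => ->.
Qed.

End Invariant.

End CosetCount.

(** * Climbing the series *)

Section Steps.

Variables (gT : finGroupType) (pi : nat_pred) (G : {group gT}).

Lemma fong_basis1 : fong_basis pi G [set: Iirr (1%G : {group gT})].
Proof.
have nG1 g : g \in 'N(1%G : {group gT}) by rewrite norm1 inE.
have I1 (phi : 'CF(1%G : {group gT})) g : g \in 'I[phi].
  rewrite inE nG1; apply/eqP/cfun_inP=> x; rewrite cfConjgE // => /set1P->.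
  by rewrite conj1g.
have eq1 (i j : Iirr (1%G : {group gT})) : i = j.
  suff /card_le1_eqP : (#|Iirr (1%G : {group gT})| <= 1)%N by apply; rewrite inE.
  by rewrite card_Iirr_abelian ?abelian1 // cards1.
split=> [i g _ _|f _ orth_f|i _]; first by rewrite inE.
  by rewrite [f]cfun_sum_cfdot big1 // => i _; rewrite orth_f ?inE ?scale0r.
exists G, 1%G, i; split.
- by rewrite setIC (setIidPl (sub1G G)).
- by rewrite mulg1; apply/esym/setIidPl/subsetP=> g _; apply: I1.
- by apply/subsetP=> g _; apply: I1.
- exact: cfInd_id.
- by have := cfDet_order_dvdG 'chi_i; rewrite cards1 dvdn1 => /eqP->.
move=> W1 _ _; rewrite indexg1 => piW1; exists W1.
have irrW1 j : 'Res[W1 :&: 1%G] 'chi[1%G]_j \in irr (W1 :&: 1%G).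
  apply/lin_char_irr/cfRes_lin_char/char_abelianP; exact: abelian1.
split=> // [|j _]; first exact: mulg1.
by rewrite (eq1 j i) eqxx irrWnorm ?irrW1.
Qed.

Section Step.

Variables (L M : {group gT}) (B : {set Iirr L}).
Hypotheses (nsLG : L <| G) (nsMG : M <| G) (sLM : L \subset M).
Hypothesis fongB : fong_basis pi G B.

Let sMG : M \subset G := normal_sub nsMG.
Let sLG : L \subset G := normal_sub nsLG.
Let nsLM : L <| M := normalS sLM sMG nsLG.
Let nMG g : g \in G -> g \in 'N(M) := subsetP (normal_norm nsMG) g.
Let nLG g : g \in G -> g \in 'N(L) := subsetP (normal_norm nsLG) g.
Let B_G := fong_conj fongB.

(** Spanning is tested at one pi-element x at a time, after restriction to L<x>. *)
Lemma fong_basis_pi_step : pi.-nat #|M : L| ->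
  fong_basis pi G [set j | [exists i in B, i \in irr_constt ('Res[L] 'chi[M]_j)]].
Proof.
move=> piML; set B' := finset _; have [_ spanB nucB] := fongB.
have B'P j : reflect (exists2 i, i \in B & i \in irr_constt ('Res[L] 'chi_j)) (j \in B').
  by rewrite inE; apply: exists_inP.
split=> [j g /B'P[i Bi ij] Gg|f pif orth_f|j /B'P[i Bi ij]].
- by apply/B'P; exists (conjg_Iirr i g); rewrite ?B_G ?constt_Res_conjg ?nMG ?nLG.
- apply/cfun_inP=> x Mx; rewrite [RHS]cfunE.
  have [pix | pi'x] := boolP (pi.-elt x); last by rewrite (cfun_on0 pif) // inE Mx.
  pose C := (L <*> <[x]>)%G.
  have nLx : <[x]> \subset 'N(L) by rewrite cycle_subG (subsetP (normal_norm nsLM)).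
  have defC : (L * <[x]>)%g = C by rewrite /= norm_joinEr.
  have sCM : C \subset M by rewrite join_subG sLM cycle_subG.
  have sCG := subset_trans sCM sMG.
  have sLC : L \subset C := joing_subl _ _.
  have nsLC : L <| C := normalS sLC sCM nsLM.
  have Cx : x \in C by rewrite (subsetP (joing_subr _ _)) ?cycle_id.
  have piCL : pi.-nat #|C : L| by apply: pnat_dvd piML; rewrite indexSg.
  have B_C : {in B & C, forall i g, conjg_Iirr i g \in B}.
    by move=> i g Bi /(subsetP sCG); apply: B_G.
  have [F FP] := fong_basis_dual fongB.
  have dualF : {in B, forall i, F i \in 'CF(L, pi_elements pi L)
      /\ {in B, forall j, '[F i, 'chi_j] = (j == i)%:R}}.
    by move=> i /FP[].
  have dualC i : i \in B -> C \subset 'I['chi_i] ->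
    forall j, i \in irr_constt ('Res[L] 'chi[C]_j) ->
    exists2 F, F \in 'CF(C, pi_elements pi C) &
      forall j', (exists2 k, k \in B & k \in irr_constt ('Res[L] 'chi[C]_j')) ->
        '['chi_j', F] = (j' == j)%:R.
    move=> Bi IC j ij; have [W [J [c nuc]]] := nucB i Bi.
    apply: nucleus_cyclic_dual nuc Bi nsLC _ piCL B_C j ij.
    by rewrite subsetI sCG.
  rewrite -(cfResE f sCM Cx).
  apply: (coset_spanning nsLC Cx defC piCL B_C spanB dualF dualC).
  + apply/cfun_onP=> y; rewrite inE; have [Cy | C'y] := boolP (y \in C); last by rewrite cfun0.
    by move=> pi'y; rewrite cfResE // (cfun_on0 pif) // inE negb_and pi'y orbT.
  + move=> j [i Bi ij]; rewrite cfdot_Res_l ['Ind _]cfun_sum_constt.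
    rewrite cfdot_sumr big1 // => k jk; rewrite cfdotZr orth_f ?mulr0 //.
    apply/B'P; exists i => //; rewrite -(cfResRes _ sLC sCM).
    apply: constt_Res_trans ij; first by rewrite cfRes_char ?irr_char.
    by rewrite -constt_Ind_Res.
  + by rewrite !inE Cx eqxx.
have [W [J [c nuc]]] := nucB i Bi.
exact: pi_step_nucleus nuc.
Qed.

End Step.

End Steps.

Section CoprimeStep.

Variables (gT : finGroupType) (pi : nat_pred) (G L M : {group gT}) (B : {set Iirr L}).
Hypotheses (nsLG : L <| G) (nsMG : M <| G) (sLM : L \subset M).
Hypothesis fongB : fong_basis pi G B.
Hypothesis piML : pi^'.-nat #|M : L|.

Let sMG : M \subset G := normal_sub nsMG.
Let sLG : L \subset G := normal_sub nsLG.
Let nsLM : L <| M := normalS sLM sMG nsLG.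
Let nMG g : g \in G -> g \in 'N(M) := subsetP (normal_norm nsMG) g.
Let nLG g : g \in G -> g \in 'N(L) := subsetP (normal_norm nsLG) g.
Let B_G := fong_conj fongB.

(** [c] restricts irreducibly to a pi-group, whose order its degree divides. *)
Lemma nucleus_pi_degree (k : Iirr L) (W J : {group gT}) (c : Iirr J) :
  nucleus pi G B k W c -> pi.-nat (Num.truncn ('chi_c 1%g)).
Proof.
case=> defJ _ _ _ _ dualc; have sJW : J \subset W by rewrite -defJ subsetIl.
have [|P [sPJ piP _ irrResP _]] := dualc J (subxx J) sJW; first by rewrite indexgg.
have /irrP[a aE] := irrResP; rewrite -(cfRes1 (P :&: L)) aE.
have := dvd_irr1_cardG a; rewrite -{1}(truncnK (Cnat_irr1 a)) dvdC_nat => dvd_a.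
by apply: pnat_dvd dvd_a _; apply: pgroupS (subsetIl P L) piP.
Qed.

(* [k] has a canonical extension to its stabilizer in [M], coming from the    *)
(* canonical extension of its nucleus; [j] is the character it induces.       *)
Lemma pi'_step_nucleus (k : Iirr L) (W J : {group gT}) (c : Iirr J) :
    k \in B -> nucleus pi G B k W c ->
  exists j : Iirr M,
    [/\ '['Res[L] 'chi_j, 'chi_k] = 1, 'I_G['chi_k] \subset 'I['chi_j]
      & forall B' : {set Iirr M},
          {in B', forall j', {subset irr_constt ('Res[L] 'chi_j') <= B}} ->
          {in B', forall j', '['Res[L] 'chi_j', 'chi_k] = (j' == j)%:R} ->
          exists (W' J' : {group gT}) (c' : Iirr J'), nucleus pi G B' j W' c'].
Proof.
move=> Bk nuc; have pi_c1 := nucleus_pi_degree nuc.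
case: nuc => defJ defIk IWc Indc pi_oc dualc.
have sWG : W \subset G by apply: subset_trans (mulG_subl L W) _; rewrite defIk subsetIl.
have nLW : W \subset 'N(L) := subset_trans sWG (normal_norm nsLG).
pose J' := (W :&: M)%G; pose T := 'I_M['chi_k]%G.
have sJ'W : J' \subset W := subsetIl _ _.
have sJ'M : J' \subset M := subsetIr _ _.
have sJL : J \subset L by rewrite -defJ subsetIr.
have sJJ' : J \subset J' by rewrite -defJ setIS.
have nsJ'W : J' <| W.
  by rewrite /normal sJ'W normsI ?normG // (subset_trans sWG) ?normal_norm.
have nsJW : J <| W by rewrite /normal -defJ subsetIl normsI ?normG.
have nsJJ' : J <| J' := normalS sJJ' sJ'W nsJW.
have defT : (L * J')%g = T.
  by rewrite group_modl // -(normC nLW) defIk setIC setIA (setIidPl sMG).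
have defJ2 : L :&: J' = J by rewrite setICA (setIidPl sLM).
have sLT : L \subset T by rewrite -[gval T]defT mulG_subl.
have sJ'T : J' \subset T by rewrite -[gval T]defT mulG_subr.
have pi'J'J : pi^'.-nat #|J' : J|.
  suff -> : #|J' : J| = #|T : L| by apply: pnat_dvd piML; rewrite indexSg ?subsetIl.
  rewrite -defJ2 setIC indexgI; apply/eqP; rewrite -(eqn_pmul2r (cardG_gt0 L)) LagrangeMr.
  by rewrite normC ?(subset_trans sJ'W) // defT -(Lagrange sLT) mulnC.
have coJ : coprime #|J' : J| ('o('chi_c)%CF * Num.truncn ('chi_c 1%g)).
  by rewrite coprime_sym (pnat_coprime _ pi'J'J) // pnatM pi_oc.
have IJ'c : J' \subset 'I['chi_c] := subset_trans sJ'W IWc.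
(* Degree and determinantal order of [c] are pi-numbers while |J' : J| is a pi'-number; the
   resulting canonical extension is fixed by [W] by uniqueness. *)
have [s [sJ os Us]] := extend_coprime_irr nsJJ' IJ'c coJ.
have IWs : W \subset 'I['chi_s].
  apply/subsetP=> w Ww.
  have nJ'w : w \in 'N(J') := subsetP (normal_norm nsJ'W) w Ww.
  have nJw : w \in 'N(J) := subsetP (normal_norm nsJW) w Ww.
  rewrite inE nJ'w -conjg_IirrE (inj_eq irr_inj); apply/eqP/Us.
    by rewrite conjg_IirrE -cfConjgRes_norm // sJ (inertiaJ (subsetP IWc w Ww)).
  rewrite conjg_IirrE /cfDet_order cfDetConjg cfConjgEin // cforder_isom -/(cfDet_order _) os.
  by move: coJ; rewrite coprimeMr => /andP[].
have /irrP[t tE] : 'Ind[T] 'chi_s \in irr T.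
  apply: (@cfRes_irr_irr _ _ L); first by rewrite cfInd_char ?irr_char.
  by rewrite (cfRes_Ind_mul _ defT defJ2) sJ Indc mem_irr.
have tL : 'Res[L] 'chi_t = 'chi_k by rewrite -tE (cfRes_Ind_mul _ defT defJ2) sJ Indc.
have [irrInd _ _ _ resInd] := constt_Inertia_bijection k nsLM.
have kt : t \in irr_constt ('Ind[T] 'chi_k) by rewrite constt_Ind_Res tL constt_irr inE.
have /irrP[j jE] := irrInd t kt.
have jInd : 'Ind[M] 'chi_s = 'chi_j.
  by rewrite -jE -tE cfIndInd ?subsetIl.
have res_jk : '['Res[L] 'chi_j, 'chi_k] = 1.
  by rewrite -jE -resInd // tL cfnorm_irr.
have kj : k \in irr_constt ('Res[L] 'chi_j) by rewrite irr_consttE res_jk oner_eq0.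
have IWj : W \subset 'I['chi_j].
  apply/subsetP=> w Ww; have Gw := subsetP sWG w Ww.
  have nJ'w : w \in 'N(J') := subsetP (normal_norm nsJ'W) w Ww.
  rewrite inE nMG //= -jInd cfConjgInd_norm ?nMG //.
  by rewrite (inertiaJ (subsetP IWs w Ww)) eqxx.
have defIj : (W * M)%g = 'I_G['chi_j].
  apply/eqP; rewrite eqEsubset mul_subG ?sub_Inertia //=; last by rewrite subsetI sWG.
  apply: subset_trans (Inertia_over_sub nsLG nsMG sLM kj) _.
  by rewrite -defIk -mulgA (mulSGid sLM).
exists j; split=> //.
  by rewrite -defIk mul_subG // (subset_trans sLM) // sub_inertia.
(* [B'] is a parameter because it is assembled only once [j] is known for every [k]. *)
move=> B' B'B B'k; exists W, J', s; split=> //; first by rewrite os.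
move=> W1 sJ'W1 sW1W piW1.
have nsJ'W1 : J' <| W1 := normalS sJ'W1 sW1W nsJ'W.
have nsJW1 : J <| W1 := normalS (subset_trans sJJ' sJ'W1) sW1W nsJW.
have nJW1 := normal_norm nsJW1.
(* Schur-Zassenhaus replaces [W1] by a pi-extension [K] of [J] with K J' = W1, to which the duality
   of the old nucleus applies. *)
have /splitsP[K1 /complP[tiK1 defK1]] : [splits (W1 / J), over (J' / J)].
  apply: SchurZassenhaus_split; last exact: quotient_normal.
  rewrite /Hall quotientS //= card_quotient ?(subset_trans sJ'W1) //.
  have -> : #|(W1 / J)%g : (J' / J)%g| = #|W1 : J'|.
    rewrite -(divgS (quotientS J sJ'W1)) /= (card_quotient nJW1).
    rewrite card_quotient ?(subset_trans sJ'W1) //.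
    by rewrite -(Lagrange_index sJ'W1 sJJ') mulnK ?indexg_gt0.
  by rewrite coprime_sym; apply: pnat_coprime piW1 pi'J'J.
have sK1 : K1 \subset (W1 / J)%g by rewrite -defK1 mulG_subr.
have [K K1E sJK sKW1] := inv_quotientS nsJW1 sK1.
have tiK : J' :&: K = J.
  apply/eqP; rewrite eqEsubset subsetI sJJ' sJK !andbT.
  rewrite -quotient_sub1 ?(subset_trans (subsetIr _ _)) ?(subset_trans sKW1) //.
  by rewrite quotientGI // -K1E tiK1.
have defW1 : (K * J')%g = W1.
  apply/eqP; rewrite eqEsubset mul_subG //= (normC (subset_trans sKW1 (normal_norm nsJ'W1))).
  rewrite -(mulSGid sJJ') -mulgA -quotientSK // quotientMl ?(subset_trans sJ'W1) //.
  by rewrite -K1E defK1.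
have piKJ : pi.-nat #|K : J|.
  suff -> : #|K : J| = #|W1 : J'| by [].
  rewrite -tiK setIC indexgI; apply/eqP; rewrite -(eqn_pmul2r (cardG_gt0 J')) LagrangeMr.
  by rewrite defW1 -(Lagrange sJ'W1) mulnC.
have [P [sPK piP defK irrResP dualP]] := dualc K sJK (subset_trans sKW1 sW1W) piKJ.
have sPW1 := subset_trans sPK sKW1; have sPW := subset_trans sPW1 sW1W.
have sPLJ : P :&: L \subset J by rewrite -defJ setSI.
(* [P] lies in [K], which meets [J'] only in [J], and [J] is contained in [L]. *)
have defPM : P :&: M = P :&: L.
  apply/eqP; rewrite eqEsubset [X in _ && X]setIS // andbT subsetI subsetIl.
  rewrite (subset_trans _ sJL) // -tiK subsetI setSI //.
  by rewrite (subset_trans (subsetIl _ _)).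
have sPE : 'Res[P :&: L] 'chi_s = 'Res[P :&: L] 'chi_c by rewrite -sJ cfResRes.
exists P; split=> //.
- by rewrite -defW1 -defK -mulgA (mulSGid sJJ').
- by rewrite defPM sPE.
move=> j' B'j'; rewrite defPM sPE -(cfResRes _ (subsetIr P L) sLM).
rewrite ['Res[L] 'chi_j']cfun_sum_constt linear_sum cfdot_suml -(B'k _ B'j').
have [kj' | k'j'] := boolP (k \in irr_constt ('Res[L] 'chi_j')).
  rewrite (bigD1 k) //= linearZ cfdotZl dualP // eqxx mulr1 big1 ?addr0 // => i /andP[ij' ne_ik].
  by rewrite linearZ cfdotZl /= dualP ?(B'B _ B'j') // (negPf ne_ik) mulr0.
rewrite big1 => [|i ij'].
  by move: k'j'; rewrite irr_consttE negbK => /eqP->.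
rewrite linearZ cfdotZl /= dualP ?(B'B _ B'j') //.
by case: eqP ij' => [-> kj'|]; [rewrite kj' in k'j' | rewrite mulr0].
Qed.

(** Each orbit representative in [B] gets its canonical character of [M], and the rest of [B'] is
    obtained by conjugation, which makes it G-stable. All pi-elements of [M] already lie in [L], so
    spanning is inherited from [B]. *)
Lemma fong_basis_pi'_step : exists B' : {set Iirr M}, fong_basis pi G B'.
Proof.
have [_ spanB nucB] := fongB.
pose rho (i : Iirr L) := odflt i [pick k in cfclass_Iirr G i].
have rho_in i : rho i \in cfclass_Iirr G i.
  rewrite /rho; case: pickP => //= /(_ i)/negP[].
  by rewrite cfclass_IirrE cfclass_refl.
have rhoE i k : k \in cfclass_Iirr G i -> rho k = rho i.
  move=> ik; have -> : rho k = odflt k [pick l in cfclass_Iirr G i].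
    by rewrite /rho; move: ik; rewrite -eq_cfclass_IirrE => /eqP->.
  by rewrite /rho; case: pickP => //= /(_ i)/negP[]; rewrite cfclass_IirrE cfclass_refl.
have rhoJ i g : g \in G -> rho (conjg_Iirr i g) = rho i.
  by move=> Gg; apply: rhoE; apply: imset_f.
have rho_id i : rho (rho i) = rho i by apply: rhoE.
have Brho i : i \in B -> rho i \in B.
  by move=> Bi; have /imsetP[g Gg ->] := rho_in i; apply: B_G.
pose good (k : Iirr L) (j : Iirr M) :=
  [/\ '['Res[L] 'chi[M]_j, 'chi_k] = 1, 'I_G['chi_k] \subset 'I['chi_j]
      & forall B' : {set Iirr M},
          {in B', forall j', {subset irr_constt ('Res[L] 'chi_j') <= B}} ->
          {in B', forall j', '['Res[L] 'chi_j', 'chi_k] = (j' == j)%:R} ->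
          exists (W' J' : {group gT}) (c' : Iirr J'), nucleus pi G B' j W' c'].
have /fin_all_exists[j jP] (k : Iirr L) : exists j, k \in B -> good k j.
  have [Bk | _] := boolP (k \in B); last by exists 0.
  have [W [J [c nuc]]] := nucB k Bk.
  by have [j jP] := pi'_step_nucleus Bk nuc; exists j.
pose B' := [set conjg_Iirr (j (rho i)) g | i in B, g in G].
have overJ k g : k \in B -> g \in G ->
    conjg_Iirr k g \in irr_constt ('Res[L] 'chi_(conjg_Iirr (j k) g)).
  move=> Bk Gg; rewrite constt_Res_conjg ?nMG ?nLG // irr_consttE.
  by have [-> _ _] := jP k Bk; rewrite oner_eq0.
have B'_G : {in B' & G, forall i g, conjg_Iirr i g \in B'}.
  move=> _ h /imset2P[i g Bi Gg ->] Gh; apply/imset2P; exists i (g * h)%g; rewrite ?groupM //.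
  by apply: irr_inj; rewrite !conjg_IirrE cfConjgMnorm ?nMG.
have overB' j' : j' \in B' -> {subset irr_constt ('Res[L] 'chi_j') <= B}.
  case/imset2P=> i g Bi Gg -> k kj.
  have [m Mm ->] := constt_Res_cfclass nsLM (overJ _ _ (Brho i Bi) Gg) kj.
  by have Gm := subsetP sMG m Mm; do 2!apply: B_G => //; apply: Brho.
have dotB' k : k \in B -> rho k = k ->
    {in B', forall j', '['Res[L] 'chi_j', 'chi_k] = (j' == j k)%:R}.
  (* If [k] lies under the g-conjugate of j(rho i), then k = rho i and g m fixes [k] for some m in
     [M]; then g m fixes j(k), and so does g. *)
  move=> Bk rk j' B'j'; have [jk1 Ijk _] := jP k Bk.
  have [-> | ne_j'] := eqVneq j' (j k); first exact: jk1.
  apply/eqP; apply: contraR ne_j' => kj'.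
  have /imset2P[i g Bi Gg j'E] := B'j'; rewrite j'E in kj' *.
  have [m Mm kE] := constt_Res_cfclass nsLM (overJ _ _ (Brho i Bi) Gg) kj'.
  have Gm := subsetP sMG m Mm.
  have ki : rho i = k by rewrite -rk kE !rhoJ // rho_id.
  have : (g * m)%g \in 'I['chi_(j k)].
    apply: (subsetP Ijk); rewrite in_setI groupM //= inE groupM ?nLG //=.
    by rewrite cfConjgMnorm ?nLG // -!conjg_IirrE -{1}ki -kE.
  move/inertiaJ; rewrite cfConjgMnorm ?nMG // (cfConjg_id _ Mm) -conjg_IirrE => /irr_inj jE.
  by rewrite ki jE.
exists B'; split=> [//|f pif orth_f|j' /imset2P[i g Bi Gg ->]]; last first.
  have Bk := Brho i Bi; have [_ _ /(_ B' overB' (dotB' _ Bk (rho_id i)))] := jP _ Bk.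
  case=> W [J [c nuc]]; exists (W :^ g)%G, (J :^ g)%G, (isom_Iirr (conj_isom J g) c).
  exact: nucleusJ.
have pi_L x : x \in M -> pi.-elt x -> x \in L.
  move=> Mx pix; have nLx := subsetP (normal_norm nsLM) x Mx; apply: coset_idr => //.
  apply/eqP; rewrite -order_eq1; apply/eqP; apply: (@pnat_1 pi).
    exact: morph_p_elt pix.
  by apply: mem_p_elt (mem_quotient L Mx); rewrite /pgroup card_quotient ?normal_norm.
have fL : f \in 'CF(M, L).
  apply: cfun_onS pif; apply/subsetP=> x; rewrite inE => /andP[]; exact: pi_L.
suff fL0 : 'Res[L] f = 0.
  apply/cfun_inP=> x Mx; rewrite [RHS]cfunE; have [Lx | L'x] := boolP (x \in L).
    by rewrite -(cfResE f sLM Lx) fL0 cfunE.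
  by rewrite (cfun_on0 fL).
apply: spanB => [|i Bi].
  apply/cfun_onP=> x; rewrite inE; have [Lx | L'x] := boolP (x \in L); last by rewrite cfun0.
  by move=> pi'x; rewrite cfResE // (cfun_on0 pif) // inE negb_and pi'x orbT.
have /imsetP[g Gg rE] := rho_in i; have [jk1 _ _] := jP _ (Brho i Bi).
pose j' := conjg_Iirr (j (rho i)) g^-1.
have B'j' : j' \in B' by apply: imset2_f; rewrite ?groupV.
have ij' : '['Res[L] 'chi_j', 'chi_i] = 1.
  have iE : 'chi_(rho i) = ('chi_i ^ g)%CF by rewrite rE conjg_IirrE.
  have [nMV nLV] : (g^-1 \in 'N(M))%g /\ (g^-1 \in 'N(L))%g by rewrite !groupV nMG ?nLG.
  by rewrite -jk1 iE conjg_IirrE -cfConjgRes_norm // -[RHS](cfConjg_iso g^-1) cfConjgK.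
have i_j' : i \in irr_constt ('Res[L] 'chi_j') by rewrite irr_consttE ij' oner_eq0.
have : '['Res[L] f, 'Res[L] 'chi_j'] = 0.
  apply: (mulfI (neq0CG L)); rewrite mulr0 cfdotE mulVKf ?neq0CG //.
  have := orth_f j' B'j'; rewrite (cfdotEl _ fL) => /eqP.
  rewrite mulf_eq0 invr_eq0 (negPf (neq0CG M)) /= => /eqP sum0; rewrite -[RHS]sum0.
  by apply: eq_bigr => x Lx; rewrite !cfResE.
(* [j'] restricts to the sum of the M-conjugates of [i], and the M-invariant function [f] has the
   same product with each of them. *)
rewrite (Clifford_Res_sum_cfclass nsLM i_j') ij' scale1r cfdot_sumr.
rewrite (eq_big_seq (fun _ => '['Res[L] f, 'chi_i])) => [|_ /cfclassP[m Mm ->]]; last first.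
  by rewrite cfdot_Res_conjg.
rewrite big_const_seq count_predT iter_addr_0 size_cfclass => /eqP.
by rewrite mulrn_eq0 -(negbK (_ == 0)%N) -lt0n indexg_gt0 => /eqP.
Qed.

End CoprimeStep.

(** * Partial characters *)

Section PartialCharacters.

Variables (gT : finGroupType) (pi : nat_pred).
Implicit Types (G H K M N : {group gT}).

Lemma pi_resD G (phi psi : 'CF(G)) : pi_res pi (phi + psi) = pi_res pi phi + pi_res pi psi.
Proof. exact: mulrDr. Qed.

Lemma pi_res_on G (phi : 'CF(G)) : pi_res pi phi \in 'CF(G, pi_elements pi G).
Proof. by apply/cfun_onP=> x /negPf pi'x; rewrite pi_resE pi'x. Qed.

Lemma pi_res1 G (phi : 'CF(G)) : pi_res pi phi 1%g = phi 1%g.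
Proof. by rewrite pi_resE inE group1 p_elt1. Qed.

Lemma pi_res_Ind G H (phi : 'CF(H)) :
  H \subset G -> 'Ind[G] (pi_res pi phi) = pi_res pi ('Ind[G] phi).
Proof.
move=> sHG; apply/cfun_inP=> x Gx; rewrite pi_resE !cfIndE // inE Gx /=.
case: ifP => pix.
  congr (_ * _); apply: eq_bigr => y _; rewrite pi_resE inE p_eltJ pix andbT.
  by have [//|H'xy] := boolP (x ^ y \in H)%g; rewrite cfun0.
rewrite big1 ?mulr0 // => y _; by rewrite pi_resE inE p_eltJ pix andbF.
Qed.

Lemma pi_res_Res G H (phi : 'CF(G)) :
  H \subset G -> 'Res[H] (pi_res pi phi) = pi_res pi ('Res[H] phi).
Proof.
move=> sHG; apply/cfun_inP=> x Hx; rewrite cfResE // !pi_resE !inE Hx cfResE //.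
by rewrite (subsetP sHG).
Qed.

Lemma pi_res_conjg G (phi : 'CF(G)) g :
  g \in 'N(G) -> (pi_res pi phi ^ g)%CF = pi_res pi (phi ^ g)%CF.
Proof.
move=> nGg; apply/cfun_inP=> x Gx; rewrite cfConjgE // !pi_resE !inE p_eltJ cfConjgE //.
by rewrite memJ_norm ?groupV.
Qed.

Lemma cfdot_pi_res G (phi F : 'CF(G)) :
  F \in 'CF(G, pi_elements pi G) -> '[pi_res pi phi, F] = '[phi, F].
Proof. by move=> piF; apply: (eq_cfdotl piF) => x pix; rewrite pi_resE pix. Qed.

Lemma pi_char_Ind G H (phi : 'CF(H)) :
  H \subset G -> pi_char pi phi -> pi_char pi ('Ind[G] phi).
Proof.
move=> sHG [chi [Nchi nz_chi ->]]; exists ('Ind[G] chi).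
by rewrite cfInd_char // cfInd_eq0 // pi_res_Ind.
Qed.

Lemma pi_char_irr G (i : Iirr G) : pi_char pi (pi_res pi 'chi_i).
Proof. by exists 'chi_i; rewrite irr_char irr_neq0. Qed.

(** A proper splitting of the lift would restrict to a splitting of the partial character. *)
Lemma pi_irr_lift G (chi : 'CF(G)) :
  chi \is a character -> pi_irr pi (pi_res pi chi) -> chi \in irr G.
Proof.
move=> Nchi [[theta [Ntheta nz_theta eq_res]] irr_chi].
have nz_chi : chi != 0.
  rewrite -char1_eq0 // -pi_res1 eq_res pi_res1 char1_eq0 //.
have [i ichi] := neq0_has_constt nz_chi.
have [psi Npsi chiE] := constt_charP i Nchi ichi.
have [psi0 | nz_psi] := eqVneq psi 0; first by rewrite chiE psi0 addr0 mem_irr.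
case: irr_chi; exists (pi_res pi 'chi_i), (pi_res pi psi); split.
- exact: pi_char_irr.
- by exists psi.
by rewrite chiE pi_resD.
Qed.

Lemma pi_irr_of_Ind G H (phi : 'CF(H)) :
  H \subset G -> pi_char pi phi -> pi_irr pi ('Ind[G] phi) -> pi_irr pi phi.
Proof.
move=> sHG Cphi [_ irrInd]; split=> // -[phi1 [phi2 [C1 C2 phiE]]].
case: irrInd; exists ('Ind[G] phi1), ('Ind[G] phi2).
by split; [apply: pi_char_Ind | apply: pi_char_Ind | rewrite phiE linearD].
Qed.

End PartialCharacters.

(** * Coordinates of partial characters *)

Section Decomposition.

Variables (gT : finGroupType) (pi : nat_pred) (G M : {group gT}) (B : {set Iirr M}).
Hypotheses (nsMG : M <| G) (fongB : fong_basis pi G B).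

Variable F : Iirr M -> 'CF(M).
Hypothesis dualF : {in B, forall i,
  [/\ F i \in 'CF(M, pi_elements pi M), F i \is a character
    & {in B, forall j, '[F i, 'chi_j] = (j == i)%:R}]}.

(** The difference of the two sides is orthogonal to every function supported on pi-elements, in
    particular to itself. *)
Lemma fong_decomposition (phi : 'CF(M)) :
  pi_res pi phi = \sum_(i in B) '[phi, F i] *: pi_res pi 'chi_i.
Proof.
pose psi := phi - \sum_(i in B) '[phi, F i] *: 'chi_i.
have psi_f f : f \in 'CF(M, pi_elements pi M) -> '[psi, f] = 0.
  move=> pif; have fE : f = \sum_(i in B) '[f, 'chi_i] *: F i.
    by apply: (pi_spanning_sum (fong_span fongB)) => // i /dualF[].
  rewrite cfdotBl {1}fE cfdot_sumr cfdot_suml -sumrB big1 // => i Bi.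
  by rewrite cfdotZr cfdotZl -cfdotC mulrC subrr.
have : pi_res pi psi = 0.
  by apply/eqP; rewrite -cfnorm_eq0 cfdot_pi_res ?pi_res_on // psi_f ?pi_res_on.
rewrite /psi /pi_res mulrBr mulr_sumr => /eqP; rewrite subr_eq0 => /eqP->.
by apply: eq_bigr => i _; rewrite scalerAr.
Qed.

Lemma fong_coef_nat (chi : 'CF(M)) i :
  chi \is a character -> i \in B -> '[chi, F i] \in Num.nat.
Proof. by move=> Nchi /dualF[_ NF _]; apply: Cnat_cfdot_char. Qed.

Lemma fong_coef_irr i j : i \in B -> j \in B -> '['chi_j, F i] = (j == i)%:R.
Proof.
move=> Bi Bj; have [_ NF dF] := dualF Bi.
by rewrite cfdotC_char ?irr_char ?dF.
Qed.

(** [F] is not assumed equivariant; conjugating the whole decomposition and reading off one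
    coordinate suffices. *)
Lemma fong_coef_conjg (chi : 'CF(M)) i g : i \in B -> g \in G ->
  (chi ^ g)%CF = chi -> '[chi, F (conjg_Iirr i g)] = '[chi, F i].
Proof.
move=> Bi Gg chig; have nMg := subsetP (normal_norm nsMG) g Gg.
have Big := fong_conj fongB Bi Gg; have [piF _ _] := dualF Big.
rewrite -(cfdot_pi_res _ piF) -{1}chig -pi_res_conjg // fong_decomposition linear_sum cfdot_suml.
rewrite (bigD1 i) //= linearZ cfdotZl /= pi_res_conjg // cfdot_pi_res // -conjg_IirrE.
rewrite fong_coef_irr // eqxx mulr1 big1 ?addr0 // => j /andP[Bj ne_ji].
rewrite linearZ cfdotZl /= pi_res_conjg // cfdot_pi_res // -conjg_IirrE.
rewrite fong_coef_irr ?(fong_conj fongB) // (inj_eq (@conjg_Iirr_inj _ _ g)) (negPf ne_ji).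
by rewrite mulr0.
Qed.

(** Natural coordinates give an ordinary character lifting [phi]; it is irreducible and a
    combination of [B], hence a member of [B]. *)
Lemma pi_irr_fong phi : pi_irr pi phi -> exists2 i, i \in B & phi = pi_res pi 'chi_i.
Proof.
move=> irr_phi; have [[chi [Nchi nz_chi phiE]] _] := irr_phi.
pose psi := \sum_(i in B) '[chi, F i] *: 'chi_i.
have Npsi : psi \is a character.
  by apply: rpred_sum => i Bi; rewrite rpredZ_nat ?irr_char ?fong_coef_nat.
have resE : phi = pi_res pi psi.
  rewrite phiE fong_decomposition /psi /pi_res mulr_sumr.
  by apply: eq_bigr => i _; rewrite scalerAr.
rewrite resE in irr_phi *; have /irrP[i psiE] := pi_irr_lift Npsi irr_phi.
exists i; last by rewrite psiE.
apply: contraT => B'i; have := cfnorm_irr i; rewrite -{1}psiE cfdot_suml big1 => [/eqP|j Bj].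
  by rewrite eq_sym oner_eq0.
rewrite cfdotZl cfdot_irr; case: eqP Bj => [-> | _]; last by rewrite mulr0.
by rewrite (negPf B'i).
Qed.

End Decomposition.

(** The series of [G] is intersected with [N]: the terms stay normal in [G], and each new index
    divides the order of the old factor. *)
Lemma fong_basis_exists (gT : finGroupType) (pi : nat_pred) (G N : {group gT}) :
  pi_separable pi G -> N <| G -> exists B : {set Iirr N}, fong_basis pi G B.
Proof.
case=> s series_s last_s nsNG.
have step (A C : {group gT}) : A <| G -> pi_factor pi G A C ->
    (exists B : {set Iirr (A :&: N)%G}, fong_basis pi G B) ->
  exists B : {set Iirr (C :&: N)%G}, fong_basis pi G B.
  move=> nsAG /and3P[sAC nsCG pi_AC] [B fongB].
  have nsAN : A :&: N <| G := normalI nsAG nsNG.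
  have nsCN : C :&: N <| G := normalI nsCG nsNG.
  have sACN : A :&: N \subset C :&: N by rewrite setSI.
  have dvd_ind : (#|(C :&: N)%G : (A :&: N)%G| %| #|(C / A)%g|)%N.
    have nAC : C \subset 'N(A) := subset_trans (normal_sub nsCG) (normal_norm nsAG).
    rewrite card_quotient //=.
    have -> : A :&: N = (C :&: N) :&: A by rewrite setIAC (setIidPr sAC).
    rewrite indexgI -(dvdn_pmul2r (cardG_gt0 A)) LagrangeMr mulnC Lagrange //.
    rewrite -norm_joinEl ?cardSg //= ?join_subG ?subsetIl //.
    by rewrite (subset_trans (subsetIl _ _)).
  case/orP: pi_AC => pi_AC.
    eexists; apply: (fong_basis_pi_step nsAN nsCN sACN fongB).
    exact: pnat_dvd dvd_ind pi_AC.
  apply: (fong_basis_pi'_step nsAN nsCN sACN fongB).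
  exact: pnat_dvd dvd_ind pi_AC.
have path_s (A : {group gT}) : A <| G ->
    (exists B : {set Iirr (A :&: N)%G}, fong_basis pi G B) ->
    forall t, (pi_factor pi G).-series A t ->
  exists B : {set Iirr (last A t :&: N)%G}, fong_basis pi G B.
  move=> nsAG fongA t; elim: t A nsAG fongA => //= C t IHt A nsAG fongA /andP[piAC path_t].
  have [_ nsCG _] := and3P piAC; apply: (IHt C) => //; exact: step piAC fongA.
have := path_s 1%G (normal1 G) _ s series_s; rewrite last_s.
have -> : (G :&: N)%G = N by apply: val_inj; rewrite /= (setIidPr (normal_sub nsNG)).
apply; have -> : (1%G :&: N)%G = 1%G by apply: val_inj; rewrite /= (setIidPl (sub1G N)).
by exists setT; apply: fong_basis1.
Qed.

(** * Induction and normal Hall subgroups *)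

Lemma dvdn_irr1_cardG (gT : finGroupType) (G : {group gT}) (i : Iirr G) :
  (Num.truncn ('chi_i 1%g) %| #|G|)%N.
Proof. by have := dvd_irr1_cardG i; rewrite -{1}(truncnK (Cnat_irr1 i)) dvdC_nat. Qed.

(** ['chi_j] extends to its stabilizer T, so by Gallagher the ratio is |K : T| times the degree of a
    character of T/N. *)
Lemma coprime_irr_degree (gT : finGroupType) (K N : {group gT}) (i : Iirr K) (j : Iirr N) :
    N <| K -> coprime #|N| #|K : N| -> j \in irr_constt ('Res[N] 'chi_i) ->
  exists2 q, (q %| #|K : N|)%N & 'chi_i 1%g = q%:R * 'chi_j 1%g.
Proof.
move=> nsNK coNK ji; have sNK := normal_sub nsNK; set T := 'I_K['chi_j]%G.
have nsNT : N <| T := normal_Inertia _ sNK; have sNT := normal_sub nsNT.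
have sTK : T \subset K := subsetIl _ _.
have co_j : coprime #|T : N| ('o('chi_j)%CF * Num.truncn ('chi_j 1%g)).
  rewrite coprime_sym; apply: coprime_dvdr (indexSg sNT sTK) _.
  rewrite coprimeMl (coprime_dvdl (cfDet_order_dvdG _)) //=.
  exact: coprime_dvdl (dvdn_irr1_cardG _) coNK.
have [e [eN _ _]] := extend_coprime_irr nsNT (subsetIr _ _) co_j.
have [_ _ imInd _ _] := constt_Inertia_bijection j nsNK.
have [irr_m _ codom_m _] := constt_Ind_ext nsNT eN.
have := imInd i; rewrite constt_Ind_Res ji => /imsetP[t jt iE].
have iInd : 'chi_i = 'Ind[K] 'chi_t.
  by rewrite iE cfIirrE //; case: (constt_Inertia_bijection j nsNK) => ->.
have /codomP[b tE] : t \in codom (@mul_mod_Iirr _ T N e) by rewrite -codom_m.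
have t1 : 'chi_t 1%g = 'chi_b 1%g * 'chi_j 1%g.
  rewrite tE cfIirrE // cfunE mod_IirrE // cfMod1; congr (_ * _).
  by rewrite -(cfRes1 N) eN.
exists (#|K : T| * Num.truncn ('chi_b 1%g))%N.
  rewrite -(Lagrange_index sTK sNT) dvdn_pmul2l ?indexg_gt0 //.
  by rewrite -card_quotient ?normal_norm ?dvdn_irr1_cardG.
by rewrite iInd cfInd1 // t1 natrM truncnK ?Cnat_irr1 // mulrA.
Qed.

Lemma cfInd_irr_irr (gT : finGroupType) (G H : {group gT}) (chi : 'CF(H)) :
  H \subset G -> chi \is a character -> 'Ind[G] chi \in irr G -> chi \in irr H.
Proof.
move=> sHG Nchi irrInd; have nz_chi : chi != 0.
  by rewrite -(cfInd_eq0 sHG) //; have /irrP[i ->] := irrInd; apply: irr_neq0.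
have [i ichi] := neq0_has_constt nz_chi.
have [psi Npsi chiE] := constt_charP i Nchi ichi.
suff /eqP psi0 : psi == 0 by rewrite chiE psi0 addr0 mem_irr.
have /irrP[j jE] := irrInd; have [k ki] := constt_cfInd_irr i sHG.
have Ni : 'Ind[G] 'chi_i \is a character by rewrite cfInd_char ?irr_char.
have Np : 'Ind[G] psi \is a character by rewrite cfInd_char.
have IndE : 'chi_j = 'Ind[G] 'chi_i + 'Ind[G] psi by rewrite -jE chiE linearD.
have kj : k = j.
  apply/eqP; rewrite -[_ == _]/(k \in pred1 j) -constt_irr IndE irr_consttE cfdotDl.
  apply: contraTN ki => /eqP e0; rewrite irr_consttE negbK.
  by move/eqP: e0; rewrite paddr_eq0 ?natr_ge0 ?Cnat_cfdot_char_irr // => /andP[].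
have [rho Nrho IndiE] := constt_charP k Ni ki.
rewrite -(cfInd_eq0 sHG) // -char1_eq0 //.
have : rho 1%g + 'Ind[G] psi 1%g = 0.
  by apply: (addrI ('chi_j 1%g)); rewrite addr0 {2}IndE !cfunE IndiE kj !cfunE addrA.
by move/eqP; rewrite paddr_eq0 ?char1_ge0 // => /andP[].
Qed.

(* ['Ind 'chi_a] has degree [m * 'chi_t 1], and [m] divides both [#|N|] and *)
(* [#|G : N|].                                                              *)
Lemma normal_Hall_Ind_irr (gT : finGroupType) (G N H : {group gT}) (h : Iirr H) a :
    N <| G -> coprime #|N| #|G : N| -> H \subset G -> 'Ind[G] 'chi_h \in irr G ->
    a \in irr_constt ('Res[H :&: N] 'chi_h) ->
  exists2 t, 'Ind[N] 'chi_a = 'chi_t & t \in irr_constt ('Res[N] ('Ind[G] 'chi_h)).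
Proof.
move=> nsNG coNG sHG irrG ah; have [sNG nNG] := andP nsNG.
pose D := (H :&: N)%G; pose K := (H <*> N)%G.
have sKG : K \subset G by rewrite join_subG sHG.
have sHK : H \subset K := joing_subl _ _; have sNK : N \subset K := joing_subr _ _.
have nsNK : N <| K := normalS sNK sKG nsNG.
have sDN : D \subset N := subsetIr _ _; have sDH : D \subset H := subsetIl _ _.
have nsDH : D <| H by rewrite /normal sDH normsI ?normG // (subset_trans sHG).
have nNH : H \subset 'N(N) := subset_trans sHG nNG.
have defK : (N * H)%g = K by rewrite -(normC nNH) /= norm_joinEl.
have defD : N :&: H = D by rewrite setIC.
have NInd : 'Ind[K] 'chi_h \is a character by rewrite cfInd_char ?irr_char.
have IndG : 'Ind[G] ('Ind[K] 'chi_h) = 'Ind[G] 'chi_h by rewrite cfIndInd.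
have /irrP[x xE] : 'Ind[K] 'chi_h \in irr K.
  by apply: (cfInd_irr_irr sKG NInd); rewrite IndG.
have ResN : 'Res[N] 'chi_x = 'Ind[N] ('Res[D] 'chi_h) by rewrite -xE (cfRes_Ind_mul _ defK defD).
have NresD : 'Res[D] 'chi_h \is a character by rewrite cfRes_char ?irr_char.
have [psi Npsi resDE] := constt_charP a NresD ah.
have NIa : 'Ind[N] 'chi_a \is a character by rewrite cfInd_char ?irr_char.
have NIp : 'Ind[N] psi \is a character by rewrite cfInd_char.
have sub_x : {subset irr_constt ('Ind[N] 'chi_a) <= irr_constt ('Res[N] 'chi_x)}.
  move=> k; rewrite ResN resDE linearD /= !irr_consttE cfdotDl; apply: contra => /eqP e0.
  by move/eqP: e0; rewrite paddr_eq0 ?natr_ge0 ?Cnat_cfdot_char_irr // => /andP[].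
have [t ta] := constt_cfInd_irr a sDN; have tx := sub_x t ta.
have coNK : coprime #|N| #|K : N| by apply: coprime_dvdr (indexSg sNK sKG) coNG.
have [q dvd_q x1] := coprime_irr_degree nsNK coNK tx.
have [n h1] := dvdn_constt_Res1_irr1 nsDH ah.
(* All constituents of the induced character lie under ['chi_x], so are conjugate to [t]; [m] counts
   them with multiplicity. *)
have [m m1] : exists m, 'Ind[N] 'chi_a 1%g = m%:R * 'chi_t 1%g.
  exists (\sum_(k in irr_constt ('Ind[N] 'chi_a)) Num.truncn '['Ind[N] 'chi_a, 'chi_k])%N.
  rewrite {1}['Ind[N] _]cfun_sum_constt sum_cfunE natr_sum mulr_suml.
  apply: eq_bigr => k ka; rewrite cfunE truncnK ?Cnat_cfdot_char_irr //; congr (_ * _).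
  by have [g Kg ->] := constt_Res_cfclass nsNK tx (sub_x k ka); rewrite conjg_IirrE cfConjg1.
have nz_t := irr1_neq0 t.
(* The degree of ['chi_x] computed twice: over [t], and as induced from [H], where |K : H| = |N :
   D|. *)
have qE : q = (n * m)%N.
  apply/eqP; rewrite -(eqr_nat algC) natrM; apply/eqP/(mulIf nz_t).
  have indexK : #|K : H| = #|N : D|.
    rewrite -defD indexgI; apply/eqP; rewrite -(eqn_pmul2r (cardG_gt0 H)) (LagrangeMr N H).
    by rewrite defK -(Lagrange sHK) mulnC.
  by rewrite -x1 -mulrA -m1 -xE !cfInd1 // h1 indexK mulrCA.
have dvd_mN : (m %| #|N|)%N.
  apply: (@dvdn_trans (#|N : D| * Num.truncn ('chi_a 1%g))).
    apply/dvdnP; exists (Num.truncn ('chi_t 1%g)); apply/eqP.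
    rewrite -(eqr_nat algC) !natrM !truncnK ?Cnat_irr1 //.
    by rewrite -cfInd1 // m1 mulrC.
  by rewrite -(Lagrange sDN) mulnC dvdn_mul ?dvdn_irr1_cardG.
have m_1 : m = 1%N.
  apply/eqP; rewrite -dvdn1 -(eqP coNK) dvdn_gcd dvd_mN (dvdn_trans _ dvd_q) //.
  by rewrite qE dvdn_mull.
have aE : 'Ind[N] 'chi_a = 'chi_t by apply: char_constt_eq; rewrite // m1 m_1 mul1r.
exists t => //; rewrite -IndG xE; have /irrP[d dE] := irrG.
rewrite -(cfResRes _ sNK sKG); apply: constt_Res_trans tx.
  by rewrite cfRes_char ?cfInd_char ?irr_char.
by rewrite -xE IndG dE -constt_Ind_Res -xE IndG dE constt_irr inE.
Qed.

(** * The character of G attached to an orbit in the basis *)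

Section OrbitCharacter.

Variables (gT : finGroupType) (pi : nat_pred) (G N : {group gT}) (B : {set Iirr N}).
Hypotheses (nsNG : N <| G) (fongB : fong_basis pi G B).

Variable F : Iirr N -> 'CF(N).
Hypothesis dualF : {in B, forall i,
  [/\ F i \in 'CF(N, pi_elements pi N), F i \is a character
    & {in B, forall j, '[F i, 'chi_j] = (j == i)%:R}]}.

Variable i : Iirr N.
Hypothesis Bi : i \in B.

(** Coprimeness extends ['chi_i] to its stabilizer; the character induced to [G] restricts to the
    orbit sum, whose coordinates are read off by duality. *)
Lemma orbit_character : coprime #|N| #|G : N| ->
  exists c : Iirr G, 'chi_c 1%g = #|G : 'I_G['chi_i]%g|%:R * 'chi_i 1%g
    /\ {in B, forall k, '['Res[N] 'chi_c, F k] = (k \in cfclass_Iirr G i)%:R}.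
Proof.
move=> coNG; have sNG := normal_sub nsNG.
set T := 'I_G['chi_i]%G; have nsNT : N <| T := normal_Inertia _ sNG.
have sNT := normal_sub nsNT; have sTG : T \subset G := subsetIl _ _.
have co_i : coprime #|T : N| ('o('chi_i)%CF * Num.truncn ('chi_i 1%g)).
  rewrite coprime_sym; apply: coprime_dvdr (indexSg sNT sTG) _.
  rewrite coprimeMl (coprime_dvdl (cfDet_order_dvdG _)) //=.
  exact: coprime_dvdl (dvdn_irr1_cardG _) coNG.
have [e [eN _ _]] := extend_coprime_irr nsNT (subsetIr _ _) co_i.
have [irrInd _ _ _ resInd] := constt_Inertia_bijection i nsNG.
have ie : e \in irr_constt ('Ind[T] 'chi_i) by rewrite constt_Ind_Res eN constt_irr inE.
have /irrP[c cE] := irrInd e ie.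
have c_i : '['Res[N] 'chi_c, 'chi_i] = 1 by rewrite -cE -resInd // eN cfnorm_irr.
have ic : i \in irr_constt ('Res[N] 'chi_c) by rewrite irr_consttE c_i oner_eq0.
exists c; split; first by rewrite -cE cfInd1 // -(cfRes1 N) eN.
move=> k Bk; rewrite (Clifford_Res_sum_cfclass nsNG ic) c_i scale1r.
rewrite reindex_cfclass // cfdot_suml cfclass_IirrE.
have inB j : 'chi_j \in ('chi_i ^: G)%CF -> j \in B.
  case/cfclassP=> g Gg jE; suff -> : j = conjg_Iirr i g by apply: (fong_conj fongB).
  by apply: irr_inj; rewrite conjg_IirrE.
have coef j : 'chi_j \in ('chi_i ^: G)%CF -> '['chi_j, F k] = (j == k)%:R.
  by move=> ij; rewrite (fong_coef_irr dualF Bk) ?inB.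
rewrite (eq_bigr _ coef); have [ik | i'k] := boolP (_ \in _).
  by rewrite (bigD1 k) //= eqxx big1 ?addr0 // => j /andP[_ /negPf->].
rewrite big1 // => j ij; case: eqP => // jk; case/negP: i'k; by rewrite -jk.
Qed.

Variable c : Iirr G.
Hypothesis coef_c : {in B, forall k, '['Res[N] 'chi_c, F k] = (k \in cfclass_Iirr G i)%:R}.

(** Coordinates of a restriction from [G] are constant on the orbit; if they vanished there, all
    would vanish and the degree would be 0. *)
Lemma orbit_coef_neq0 (chi : 'CF(G)) : chi \is a character -> chi != 0 ->
    {in B, forall k, '['Res[N] chi, F k] <= (k \in cfclass_Iirr G i)%:R} ->
  0 < '['Res[N] chi, F i].
Proof.
move=> Nchi nz_chi le_coef; have NR : 'Res[N] chi \is a character by rewrite cfRes_char.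
have natF k : k \in B -> '['Res[N] chi, F k] \in Num.nat.
  by move=> Bk; exact: (fong_coef_nat dualF NR Bk).
rewrite lt_def natr_ge0 ?natF // andbT.
apply: contraNneq nz_chi => chi_i.
rewrite -char1_eq0 // -(cfRes1 N) -(pi_res1 pi) (fong_decomposition fongB dualF).
rewrite big1 ?cfunE // => k Bk.
have [/imsetP[g Gg kE] | i'k] := boolP (k \in cfclass_Iirr G i).
  rewrite kE (fong_coef_conjg nsNG fongB dualF) ?chi_i ?scale0r //.
  by rewrite (cfConjgRes _ _ nsNG) // cfConjg_id.
have := le_coef k Bk; rewrite (negPf i'k) => le0.
suff -> : '['Res[N] chi, F k] = 0 by rewrite scale0r.
by apply: le_anti; rewrite le0 natr_ge0 ?natF.
Qed.

(** Each of two summands would contribute at least 1 to the coordinate at [i], which is only 1. *)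
Lemma orbit_pi_irr : pi_irr pi (pi_res pi 'chi_c).
Proof.
have sNG := normal_sub nsNG; split; first exact: pi_char_irr.
case=> _ [_ [[chi1 [N1 nz1 ->]] [chi2 [N2 nz2 ->]] cE12]].
have NR (chi : 'CF(G)) : chi \is a character -> 'Res[N] chi \is a character.
  by move=> Nchi; rewrite cfRes_char.
have coef12 k : k \in B ->
    '['Res[N] chi1, F k] + '['Res[N] chi2, F k] = (k \in cfclass_Iirr G i)%:R.
  move=> Bk; rewrite -coef_c //; have [piF _ _] := dualF Bk.
  rewrite -(cfdot_pi_res ('Res[N] 'chi_c) piF) -pi_res_Res // cE12 linearD cfdotDl /=.
  by rewrite !pi_res_Res // !cfdot_pi_res.
have ge0 (chi : 'CF(G)) k : chi \is a character -> k \in B -> 0 <= '['Res[N] chi, F k].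
  by move=> Nchi Bk; rewrite natr_ge0 ?(fong_coef_nat dualF) ?NR.
have gt0_1 : 0 < '['Res[N] chi1, F i].
  by apply: orbit_coef_neq0 => // k Bk; rewrite -coef12 // lerDl ge0.
have gt0_2 : 0 < '['Res[N] chi2, F i].
  by apply: orbit_coef_neq0 => // k Bk; rewrite -coef12 // lerDr ge0.
have ii : i \in cfclass_Iirr G i by rewrite cfclass_IirrE cfclass_refl.
have := coef12 i Bi; rewrite ii.
have := fong_coef_nat dualF (NR _ N1) Bi; have := fong_coef_nat dualF (NR _ N2) Bi.
move=> /natrP[a2 a2E] /natrP[a1 a1E]; move: gt0_1 gt0_2; rewrite a1E a2E !ltr0n -natrD.
move=> a1_gt0 a2_gt0 /eqP; rewrite (eqr_nat _ _ 1).
by rewrite gtn_eqF ?(leq_add a1_gt0 a2_gt0).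
Qed.

(* The sum of the coordinates of ['chi_t], all on conjugates of ['chi_i], *)
(* divides both [#|N|] and [#|G : N|].                                    *)
Lemma orbit_constituent (x : Iirr G) (t : Iirr N) : coprime #|N| #|G : N| ->
    'chi_c 1%g = #|G : 'I_G['chi_i]%g|%:R * 'chi_i 1%g ->
    pi_res pi 'chi_x = pi_res pi 'chi_c -> t \in irr_constt ('Res[N] 'chi_x) ->
  exists2 g, g \in G & pi_res pi 'chi_t = (pi_res pi 'chi_i ^ g)%CF.
Proof.
move=> coNG c1 xc tx; have sNG := normal_sub nsNG.
set T := 'I_G['chi_i]%G; have nsNT : N <| T := normal_Inertia _ sNG.
have sNT := normal_sub nsNT; have sTG : T \subset G := subsetIl _ _.
have Nx : 'Res[N] 'chi_x \is a character by rewrite cfRes_char ?irr_char.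
have [rho Nrho resx] := constt_charP t Nx tx.
have le_t k : k \in B -> '['chi_t, F k] <= (k \in cfclass_Iirr G i)%:R.
  move=> Bk; rewrite -coef_c //; have [piF NF _] := dualF Bk.
  rewrite -(cfdot_pi_res ('Res[N] 'chi_c) piF) -pi_res_Res // -xc pi_res_Res // cfdot_pi_res //.
  by rewrite resx cfdotDl lerDl natr_ge0 ?Cnat_cfdot_char.
have /fin_all_exists[m mE] k : exists n, k \in B -> '['chi_t, F k] = n%:R.
  have [Bk | _] := boolP (k \in B); last by exists 0%N.
  by have /natrP[n nE] := fong_coef_nat dualF (irr_char t) Bk; exists n.
have m_orbit k : k \in B -> (m k <= (k \in cfclass_Iirr G i))%N.
  by move=> Bk; rewrite -(ler_nat algC) -mE // le_t.
have tE : pi_res pi 'chi_t = \sum_(k in B) (m k)%:R *: pi_res pi 'chi_k.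
  rewrite (fong_decomposition fongB dualF); apply: eq_bigr => k Bk; by rewrite mE.
have t1 : 'chi_t 1%g = (\sum_(k in B) m k)%:R * 'chi_i 1%g.
  rewrite -(pi_res1 pi) tE sum_cfunE natr_sum mulr_suml; apply: eq_bigr => k Bk.
  rewrite cfunE pi_res1; have := m_orbit k Bk.
  have [/imsetP[g Gg ->] _ | _] := boolP (k \in _); first by rewrite conjg_IirrE cfConjg1.
  by rewrite leqn0 => /eqP->; rewrite !mul0r.
have [q dvd_q x1] := coprime_irr_degree nsNG coNG tx.
have nz_i := irr1_neq0 i.
(* ['chi_x] and ['chi_c] agree at the identity: q times the degree of [t] equals |G : T| times that
   of [i]. *)
have qm : (q * \sum_(k in B) m k = #|G : T|)%N.
  apply/eqP; rewrite -(eqr_nat algC) natrM; apply/eqP/(mulIf nz_i).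
  by rewrite -mulrA -t1 -x1 -(pi_res1 pi) xc pi_res1 c1.
have dvd_mG : (\sum_(k in B) m k %| #|G : N|)%N.
  by rewrite -(Lagrange_index sTG sNT) dvdn_mulr // -qm dvdn_mull.
have dvd_mN : (\sum_(k in B) m k %| #|N|)%N.
  apply: dvdn_trans (dvdn_irr1_cardG t); apply/dvdnP; exists (Num.truncn ('chi_i 1%g)).
  by apply/eqP; rewrite -(eqr_nat algC) natrM !truncnK ?Cnat_irr1 // t1 mulrC.
have m1 : (\sum_(k in B) m k = 1)%N.
  by apply/eqP; rewrite -dvdn1 -(eqP coNG) dvdn_gcd dvd_mN.
have [k [Bk mk m0]] : exists k, [/\ k \in B, m k = 1%N & {in B, forall j, j != k -> m j = 0%N}].
  have : (exists2 k, k \in B & m k != 0%N).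
    apply/exists_inP; apply: contraT; rewrite negb_exists_in => /forall_inP m0.
    by move/eqP: m1; rewrite big1 // => k Bk; apply/eqP; rewrite -[_ == _]negbK m0.
  case=> k Bk nz_k; have sum1 := m1; rewrite (bigD1 k) //= in sum1; exists k.
  have mk : m k = 1%N by apply/eqP; rewrite eqn_leq lt0n nz_k andbT -sum1 leq_addr.
  split=> // j Bj ne_jk; apply/eqP; rewrite -leqn0.
  by move/eqP: sum1; rewrite mk (bigD1 j) ?Bj //= add1n eqSS addn_eq0 leqn0 => /andP[].
have := m_orbit k Bk; rewrite mk lt0b => /imsetP[g Gg kE].
exists g => //; rewrite tE (bigD1 k) //= mk scale1r big1 ?addr0 => [|j /andP[Bj ne_jk]].
  by rewrite kE conjg_IirrE pi_res_conjg // (subsetP (normal_norm nsNG)).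
by rewrite m0 // scale0r.
Qed.

End OrbitCharacter.

(** * Descent of pseudo monomiality to the normal Hall subgroup *)

Theorem theorem3p3 (gT : finGroupType) (pi : nat_pred) (G N : {group gT}) :
  pi_separable pi G -> pseudo_M_group pi G ->
  (N <| G)%g -> Hall G N -> pseudo_M_group pi N.
Proof.
move=> sepG psMG nsNG /andP[sNG coNG] phi irr_phi.
have [B fongB] := fong_basis_exists sepG nsNG.
have [F dualF] := fong_basis_dual fongB.
have [i Bi phiE] := pi_irr_fong fongB dualF irr_phi.
have [c [c1 coef_c]] := orbit_character nsNG fongB dualF Bi coNG.
have irr_c := orbit_pi_irr nsNG fongB dualF Bi coef_c.
have [_ gcdG] := psMG _ irr_c; split=> [n _|d dvd_d]; first exact: dvd1n.
(* It is enough that a common divisor [d] of the degrees inducing [phi] divides every degree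
   inducing the restriction of ['chi_c], whose gcd is 1. *)
apply: gcdG => n [H [psi [[sHG irr_psi IndE] psi1]]].
have [[chi [Nchi nz_chi psiE]] _] := irr_psi.
rewrite psiE in irr_psi IndE psi1; have /irrP[h hE] := pi_irr_lift Nchi irr_psi.
rewrite hE in irr_psi IndE psi1; rewrite pi_res1 in psi1.
rewrite pi_res_Ind // in IndE.
have irrG : 'Ind[G] 'chi_h \in irr G.
  by apply: (@pi_irr_lift _ pi); rewrite ?IndE ?cfInd_char ?irr_char.
pose D := (H :&: N)%G; have [a ah] := neq0_has_constt (Res_irr_neq0 D h).
have [t aE ta] := normal_Hall_Ind_irr nsNG coNG sHG irrG ah.
have /irrP[x xE] := irrG; rewrite xE in ta IndE.
have [g Gg tE] := orbit_constituent nsNG fongB dualF coef_c coNG c1 IndE ta.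
have nsDH : D <| H.
  by rewrite /normal subsetIl normsI ?normG // (subset_trans sHG) ?normal_norm.
have [k h1] := dvdn_constt_Res1_irr1 nsDH ah.
(* [a] induces a lift of the g-conjugate of [phi], so its conjugate by the inverse of g induces
   [phi] itself. *)
set D' := (D :^ g^-1)%G; pose b : Iirr D' := isom_Iirr (conj_isom D g^-1) a.
have bE : 'chi_b = cfJ g^-1 'chi_a by rewrite isom_IirrE.
have sDN : D \subset N := subsetIr H N.
have nNg : g^-1%g \in 'N(N) by rewrite groupV (subsetP (normal_norm nsNG)).
have sD'N : D' \subset N by rewrite -(normP nNg) conjSg.
have Indb : 'Ind[N] (pi_res pi 'chi_b) = phi.
  rewrite pi_res_Ind // bE cfInd_J_norm // aE -pi_res_conjg // tE phiE.
  by rewrite cfConjgK ?(subsetP (normal_norm nsNG)) ?(subsetP sNG).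
have b1 : 'chi_b 1%g = 'chi_a 1%g by rewrite bE cfJE conj1g.
have /natrP[n' a1] := Cnat_irr1 a.
apply: (@dvdn_trans n').
  apply: dvd_d; exists D', (pi_res pi 'chi_b); rewrite pi_res1 b1; split=> //; split=> //.
  apply: (pi_irr_of_Ind sD'N (pi_char_irr _ b)); by rewrite Indb.
(* [k] is the Clifford ratio of the degrees of [h] and [a]. *)
apply/dvdnP; exists k; apply/eqP.
by rewrite -(eqr_nat algC) -psi1 h1 a1 natrM.
Qed.
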